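(* Fix an integer $k\ge 1$. There is an algorithm that, given a graph $G$ with $n$ vertices and $m$ edges, decides in time $O(n^{k+4}(n+m))$ whether $G$ is a proper $k$-color-line graph; moreover, if $G$ is a proper $k$-color-line graph, the algorithm outputs within the same time bound a graph $H$ together with a proper edge $k$-coloring of $H$ such that $G\cong\mathrm{CL}(H)$.
   Context: An edge $k$-coloring of a graph $H$ is a map $\phi:E(H)\to\{1,\dots,k\}$; it is proper if any two distinct edges sharing an endvertex get different colors. For an edge-colored graph $(H,\phi)$, the color-line graph $\mathrm{CL}(H)$ has vertex set $E(H)$, two distinct vertices being adjacent iff the corresponding edges of $H$ share an endvertex or have the same color. $G$ is a proper $k$-color-line graph if $G\cong\mathrm{CL}(H)$ for some graph $H$ with a proper edge $k$-coloring. *)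

(* Defs.v *)
From mathcomp Require Import all_boot.

Set Implicit Arguments.
Unset Strict Implicit.
Unset Printing Implicit Defensive.

(** * Finite simple graphs and color-line graphs *)

Record sgraph := SGraph {
  vert :> finType;
  adj : rel vert;
  adj_sym : symmetric adj;
  adj_irr : irreflexive adj }.

Definition edge_set (G : sgraph) : {set {set G}} :=
  [set [set x; y] | x in G, y in G & adj x y].

Definition edge (G : sgraph) : finType := {e : {set G} | e \in edge_set G}.

Definition share_end (H : sgraph) (e f : edge H) : bool :=
  val e :&: val f != set0.

(* ['I_k] stands for the color set {1, ..., k}. *)
Definition proper_coloring (k : nat) (H : sgraph) (phi : edge H -> 'I_k) : Prop :=
  forall e f : edge H, e != f -> share_end e f -> phi e != phi f.

Section ColorLine.
Variables (k : nat) (H : sgraph) (phi : edge H -> 'I_k).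

Definition cl_adj : rel (edge H) :=
  fun e f => (e != f) && (share_end e f || (phi e == phi f)).

Lemma cl_adj_sym : symmetric cl_adj.
Proof.
by move=> e f; rewrite /cl_adj /share_end eq_sym setIC [phi e == _]eq_sym.
Qed.

Lemma cl_adj_irr : irreflexive cl_adj.
Proof. by move=> e; rewrite /cl_adj eqxx. Qed.

Definition CL : sgraph := SGraph cl_adj_sym cl_adj_irr.
End ColorLine.

Definition graph_iso (G G' : sgraph) : Prop :=
  exists2 f : G -> G', bijective f & forall x y, adj (f x) (f y) = adj x y.

Definition proper_color_line_graph (k : nat) (G : sgraph) : Prop :=
  exists (H : sgraph) (phi : edge H -> 'I_k),
    proper_coloring phi /\ graph_iso G (CL phi).

(** * Word RAM

    Programs are structured imperative programs over registers and arrays of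
    natural numbers. Register and array names are fixed in the program text,
    so a program uses finitely many of each; array indices are computed. Every
    arithmetic operation, comparison, register or array access, assignment and
    test has cost 1. All numbers that occur must be smaller than the word bound
    [W]: a program that exceeds it has no execution. Taking [W] polynomial in
    the input size gives the usual model with words of O(log n) bits. *)

Inductive binop := Add | Sub | Mul | Div | Eq | Lt.

Inductive expr :=
  | Lit of nat
  | Reg of nat
  | Read of nat & expr
  | Bin of binop & expr & expr.

Inductive cmd :=
  | Skip
  | Assign of nat & expr
  | Write of nat & expr & expr
  | Seq of cmd & cmd
  | If of expr & cmd & cmd
  | While of expr & cmd.

Record state := State { reg : nat -> nat; arr : nat -> nat -> nat }.

Definition set_reg (s : state) (r v : nat) : state :=
  State (fun r' => if r' == r then v else reg s r') (arr s).

Definition set_arr (s : state) (a i v : nat) : state :=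
  State (reg s)
    (fun a' i' => if (a' == a) && (i' == i) then v else arr s a' i').

(* Subtraction is truncated and [x / 0 = 0]; comparisons return 0 or 1. *)
Definition eval_op (o : binop) (x y : nat) : nat :=
  match o with
  | Add => x + y
  | Sub => x - y
  | Mul => x * y
  | Div => x %/ y
  | Eq => x == y
  | Lt => x < y
  end.

Fixpoint eval (s : state) (e : expr) : nat :=
  match e with
  | Lit v => v
  | Reg r => reg s r
  | Read a i => arr s a (eval s i)
  | Bin o e1 e2 => eval_op o (eval s e1) (eval s e2)
  end.

Fixpoint fits (W : nat) (s : state) (e : expr) : bool :=
  (eval s e < W) &&
  match e with
  | Lit _ | Reg _ => true
  | Read _ i => fits W s i
  | Bin _ e1 e2 => fits W s e1 && fits W s e2
  end.

Fixpoint cost (e : expr) : nat :=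
  match e with
  | Lit _ | Reg _ => 1
  | Read _ i => (cost i).+1
  | Bin _ e1 e2 => (cost e1 + cost e2).+1
  end.

(* [exec W p s s' t]: with word bound [W], the program [p] started in [s]
   halts in [s'] after [t] steps. *)
Inductive exec (W : nat) : cmd -> state -> state -> nat -> Prop :=
  | ExecSkip s : exec W Skip s s 1
  | ExecAssign s r e :
      fits W s e ->
      exec W (Assign r e) s (set_reg s r (eval s e)) (cost e).+1
  | ExecWrite s a i e :
      fits W s i -> fits W s e ->
      exec W (Write a i e) s (set_arr s a (eval s i) (eval s e))
        (cost i + cost e).+1
  | ExecSeq s1 s2 s3 c1 c2 t1 t2 :
      exec W c1 s1 s2 t1 -> exec W c2 s2 s3 t2 ->
      exec W (Seq c1 c2) s1 s3 (t1 + t2)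
  | ExecIf s s' b c1 c2 t :
      fits W s b -> exec W (if eval s b != 0 then c1 else c2) s s' t ->
      exec W (If b c1 c2) s s' (cost b + t).+1
  | ExecWhileStop s b c :
      fits W s b -> eval s b = 0 ->
      exec W (While b c) s s (cost b).+1
  | ExecWhileStep s1 s2 s3 b c t1 t2 :
      fits W s1 b -> eval s1 b != 0 ->
      exec W c s1 s2 t1 -> exec W (While b c) s2 s3 t2 ->
      exec W (While b c) s1 s3 (cost b + t1 + t2).+1.

(** * Input and output conventions *)

(* [es] lists every edge of [G] exactly once, in any order and orientation. *)
Definition edge_list (G : sgraph) (es : seq (G * G)) : Prop :=
  perm_eq [seq [set p.1; p.2] | p <- es] (enum (edge_set G)).

Definition tails (G : sgraph) (es : seq (G * G)) : seq nat :=
  [seq nat_of_ord (enum_rank p.1) | p <- es].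

Definition heads (G : sgraph) (es : seq (G * G)) : seq nat :=
  [seq nat_of_ord (enum_rank p.2) | p <- es].

(* Vertices are numbered 0, ..., n - 1. Registers 0 and 1 hold the numbers of
   vertices and edges, arrays 0 and 1 the two ends of the listed edges; all
   other memory is zero. *)
Definition input_state (G : sgraph) (es : seq (G * G)) : state :=
  State (nth 0 [:: #|G|; size es])
        (fun a => nth 0 (nth [::] [:: tails es; heads es] a)).

Definition accepts (s : state) : Prop := reg s 2 != 0.

(* Registers 3 and 4 hold the numbers of vertices and edges of [H]; arrays 2
   and 3 the two ends and array 4 the color of each edge. *)
Definition outputs (s : state) (k : nat) (H : sgraph) (phi : edge H -> 'I_k)
    : Prop :=
  exists es : seq (H * H),
    [/\ edge_list es,
        reg s 3 = #|H| /\ reg s 4 = size es,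
        mkseq (arr s 2) (size es) = tails es /\
        mkseq (arr s 3) (size es) = heads es
      & forall (e : edge H) (i : nat) (p : H * H),
          onth es i = Some p -> val e = [set p.1; p.2] ->
          arr s 4 i = phi e].

(* Main.v *)
Require Import Defs.
From mathcomp Require Import all_boot zify.

(** In a proper [k]-color-line graph [G] the color classes are [k] cliques, and
    removing the edges inside them leaves the line graph [L] of [H]. A vertex
    has at most two neighbors in a class other than its own (one per end of the
    edge it stands for), so three vertices of a class determine it: the class
    contains every vertex adjacent to all three. Hence a string of [3 k]
    guessed colors, each given to some uncolored vertex and followed by
    absorbing the vertices with three neighbors of that color, produces the
    whole partition, and the number of such strings does not depend on [G].

    Let [x v u] say at which end of the edge [v] it meets the edge [u]. Such a
    family comes from a root graph iff, for neighbors [u <> w] of [v] in [L],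
    [x v u = x v w] holds exactly when [u] and [w] are adjacent in [L] and
    [x u v = x u w]. The values at [v] determine those at its neighbors up to
    exchanging ends, so a component of [L] is solved by trying the values at
    one vertex and propagating; two neighbors of a vertex with the same color
    lie at different ends, so a subset of the colors encodes these values.
    The ends [(v, t)], identified along [L], are the vertices of [H]. *)

Set Implicit Arguments.
Unset Strict Implicit.
Unset Printing Implicit Defensive.

(** * Programs with bounded loops *)

(* [PFor r b p] runs [p] for each value of register [r] below register [b]; the
   loop bounds are the registers 0, 1 and 3, which are never written, so that
   running time and word size can be bounded from the program text. *)
Inductive prog :=
  | PSkip
  | PAsg of nat & expr
  | PWr of nat & expr & expr
  | PSeq of prog & prog
  | PIf of expr & prog & prog
  | PFor of nat & nat & prog.

Definition loop_test (r b : nat) : expr := Bin Lt (Reg r) (Reg b).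
Definition incr (r : nat) : cmd := Assign r (Bin Add (Reg r) (Lit 1)).

Fixpoint compile (p : prog) : cmd :=
  match p with
  | PSkip => Skip
  | PAsg r e => Assign r e
  | PWr a i e => Write a i e
  | PSeq p1 p2 => Seq (compile p1) (compile p2)
  | PIf e p1 p2 => If e (compile p1) (compile p2)
  | PFor r b p =>
      Seq (Assign r (Lit 0)) (While (loop_test r b) (Seq (compile p) (incr r)))
  end.

Fixpoint run (p : prog) (s : state) : state :=
  match p with
  | PSkip => s
  | PAsg r e => set_reg s r (eval s e)
  | PWr a i e => set_arr s a (eval s i) (eval s e)
  | PSeq p1 p2 => run p2 (run p1 s)
  | PIf e p1 p2 => if eval s e != 0 then run p1 s else run p2 s
  | PFor r b p =>
      iteri (reg s b) (fun i s' => set_reg (run p s') r i.+1) (set_reg s r 0)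
  end.

Fixpoint nwr (r : nat) (p : prog) : bool :=
  match p with
  | PSkip | PWr _ _ _ => true
  | PAsg r' _ => r' != r
  | PSeq p1 p2 | PIf _ p1 p2 => nwr r p1 && nwr r p2
  | PFor r' _ p => (r' != r) && nwr r p
  end.

Fixpoint nwa (a : nat) (p : prog) : bool :=
  match p with
  | PSkip | PAsg _ _ => true
  | PWr a' _ _ => a' != a
  | PSeq p1 p2 | PIf _ p1 p2 => nwa a p1 && nwa a p2
  | PFor _ _ p => nwa a p
  end.

Lemma reg_run r p s : nwr r p -> reg (run p s) r = reg s r.
Proof.
elim: p s => [|r' e|a i e|p1 IH1 p2 IH2|e p1 IH1 p2 IH2|r' b p IH] s //=.
- by rewrite eq_sym => /negbTE->.
- by case/andP=> h1 h2; rewrite IH2 // IH1.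
- by case/andP=> h1 h2; case: ifP => _; rewrite ?IH1 ?IH2.
- case/andP=> /negbTE h1 h2; elim: (reg s b) => [|n IHn] /=; rewrite eq_sym h1 //.
  by rewrite IH.
Qed.

Lemma arr_run a p s i : nwa a p -> arr (run p s) a i = arr s a i.
Proof.
elim: p s => [|r' e|a' j e|p1 IH1 p2 IH2|e p1 IH1 p2 IH2|r' b p IH] s //=.
- by rewrite eq_sym => /negbTE->.
- by case/andP=> h1 h2; rewrite IH2 // IH1.
- by case/andP=> h1 h2; case: ifP => _; rewrite ?IH1 ?IH2.
- by move=> h; elim: (reg s b) => [|n IHn] //=; rewrite IH.
Qed.

(* The values of these expressions never exceed the contents of the memory. *)
Fixpoint nogrow (e : expr) : bool :=
  match e with
  | Lit _ | Reg _ | Read _ _ => true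
  | Bin Add _ _ | Bin Mul _ _ => false
  | Bin Defs.Sub e _ | Bin Div e _ => nogrow e
  | Bin Eq _ _ | Bin Lt _ _ => true
  end.

Definition is_bound (b : nat) : bool := b \in [:: 0; 1; 3].

Fixpoint wf (p : prog) : bool :=
  match p with
  | PSkip => true
  | PAsg r e => ~~ is_bound r && nogrow e
  | PWr _ _ e => nogrow e
  | PSeq p1 p2 | PIf _ p1 p2 => wf p1 && wf p2
  | PFor r b p => [&& ~~ is_bound r, is_bound b, nwr r p & wf p]
  end.

Lemma wf_nwr r p : wf p -> is_bound r -> nwr r p.
Proof.
move=> + hr; elim: p => //=.
- by move=> r' e /andP[h _]; apply: contra h => /eqP->.
- by move=> p1 IH1 p2 IH2 /andP[/IH1-> /IH2->].
- by move=> e p1 IH1 p2 IH2 /andP[/IH1-> /IH2->].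
- move=> r' b p IH /and4P[h _ _ /IH->]; rewrite andbT.
  by apply: contra h => /eqP->.
Qed.

(** * Word size and running time of bounded programs *)

Fixpoint elit (e : expr) : nat :=
  match e with
  | Lit v => v
  | Reg _ => 0
  | Read _ i => elit i
  | Bin _ e1 e2 => maxn (elit e1) (elit e2)
  end.

Fixpoint maxlit (p : prog) : nat :=
  match p with
  | PSkip => 0
  | PAsg _ e => elit e
  | PWr _ i e => maxn (elit i) (elit e)
  | PSeq p1 p2 => maxn (maxlit p1) (maxlit p2)
  | PIf e p1 p2 => maxn (elit e) (maxn (maxlit p1) (maxlit p2))
  | PFor _ _ p => maxlit p
  end.

(** An exponent for intermediate values: over a memory with contents below [B], every value met
    while evaluating [e] is below [B ^ esz e]. A read returns memory contents, so only its index
    counts. *)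
Fixpoint esz (e : expr) : nat :=
  match e with
  | Lit _ | Reg _ => 1
  | Read _ i => esz i
  | Bin _ e1 e2 => esz e1 + esz e2
  end.

Fixpoint maxesz (p : prog) : nat :=
  match p with
  | PSkip => 1
  | PAsg _ e => esz e
  | PWr _ i e => maxn (esz i) (esz e)
  | PSeq p1 p2 => maxn (maxesz p1) (maxesz p2)
  | PIf e p1 p2 => maxn (esz e) (maxn (maxesz p1) (maxesz p2))
  | PFor _ _ p => maxesz p
  end.

Definition bounded (B : nat) (s : state) : Prop :=
  (forall r, reg s r < B) /\ (forall a i, arr s a i < B).

Lemma esz_gt0 e : 0 < esz e.
Proof. by elim: e => //= o e1 h1 e2 h2; rewrite addn_gt0 h1. Qed.

Lemma eval_lt B s e :
  1 < B -> bounded B s -> elit e < B -> eval s e < B ^ esz e.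
Proof.
move=> B1 [hr ha]; elim: e => [v|r|a i IH|o e1 IH1 e2 IH2] /=; rewrite ?expn1 //.
- move=> _; apply: leq_trans (ha _ _) _.
  by rewrite -[leqLHS]expn1 leq_exp2l // esz_gt0.
- rewrite gtn_max => /andP[/IH1 h1 /IH2 h2]; rewrite expnD.
  have g1 : 1 < B ^ esz e1 by rewrite -[1](expn0 B) ltn_exp2l // esz_gt0.
  have g2 : 1 < B ^ esz e2 by rewrite -[1](expn0 B) ltn_exp2l // esz_gt0.
  move: (eval s e1) (eval s e2) (B ^ esz e1) (B ^ esz e2) h1 h2 g1 g2 => x y X Y h1 h2 g1 g2.
  have hXY : X <= X * Y by rewrite leq_pmulr //; lia.
  have h : x < X * Y by apply: leq_trans hXY.
  (* Both factors exceed 1, so the product of the bounds also dominates the sum. *)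
  case: o => /=; first by nia.
  - exact: leq_ltn_trans (leq_subr _ _) h.
  - by nia.
  - exact: leq_ltn_trans (leq_div _ _) h.
  - by apply: leq_ltn_trans (leq_b1 _) _; nia.
  - by apply: leq_ltn_trans (leq_b1 _) _; nia.
Qed.

Lemma eval_fits W B s e :
  1 < B -> bounded B s -> elit e < B -> B ^ esz e <= W -> fits W s e.
Proof.
move=> B1 hs he hW.
have B0 : 0 < B by lia.
elim: e he hW => [v|r|a i IH|o e1 IH1 e2 IH2] he hW;
  have /= lt := eval_lt B1 hs he; rewrite /= (leq_trans lt) //=.
- by rewrite IH.
- move: he hW; rewrite /= gtn_max => /andP[he1 he2] hW.
  rewrite IH1 // ?IH2 //; apply: leq_trans hW; rewrite leq_exp2l //; lia.
Qed.

Lemma nogrow_lt B s e :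
  1 < B -> bounded B s -> elit e < B -> nogrow e -> eval s e < B.
Proof.
move=> B1 [hr ha]; elim: e => //= o e1 IH1 e2 _; rewrite gtn_max.
case/andP=> he1 _; case: o => //= h.
- by apply: leq_ltn_trans (leq_subr _ _) _; apply: IH1.
- by apply: leq_ltn_trans (leq_div _ _) _; apply: IH1.
- by case: eqP; lia.
- by case: ltnP; lia.
Qed.

(** Register 1 holds the number of edges, at most [n ^ 2]; the other loop bounds are [n] and
    [2 n]. *)
Definition bdeg (b : nat) : nat := if b == 1 then 2 else 1.

Fixpoint deg (p : prog) : nat :=
  match p with
  | PSkip | PAsg _ _ | PWr _ _ _ => 0
  | PSeq p1 p2 | PIf _ p1 p2 => maxn (deg p1) (deg p2)
  | PFor _ b p => bdeg b + deg p
  end.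

(** A loop makes at most [2 * n ^ bdeg b] iterations, each with an overhead of 8 steps, and has a
    fixed cost of 6; this gives the factor 2 and the constant 22. *)
Fixpoint coef (p : prog) : nat :=
  match p with
  | PSkip => 1
  | PAsg _ e => (cost e).+1
  | PWr _ i e => (cost i + cost e).+1
  | PSeq p1 p2 => coef p1 + coef p2
  | PIf e p1 p2 => (cost e + (coef p1 + coef p2)).+1
  | PFor _ _ p => 2 * coef p + 22
  end.

Definition sizes_ok (n : nat) (s : state) : Prop :=
  [/\ reg s 0 = n, reg s 1 <= n ^ 2 & reg s 3 = n + n].

Lemma sizes_run n p s : wf p -> sizes_ok n s -> sizes_ok n (run p s).
Proof. by move=> w [h0 h1 h3]; split; rewrite reg_run // wf_nwr. Qed.

Lemma sizes_set_reg n s r v :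
  ~~ is_bound r -> sizes_ok n s -> sizes_ok n (set_reg s r v).
Proof.
rewrite /is_bound !inE !negb_or => /and3P[/negbTE h0 /negbTE h1 /negbTE h3].
by case=> ???; split=> //=; rewrite eq_sym ?h0 ?h1 ?h3.
Qed.

Lemma bounded_set_reg B s r v : v < B -> bounded B s -> bounded B (set_reg s r v).
Proof. by move=> hv [hr ha]; split=> //= r'; case: ifP. Qed.

Lemma sizes_iter n s b : is_bound b -> sizes_ok n s -> reg s b <= 2 * n ^ bdeg b.
Proof. by rewrite /is_bound !inE => /or3P[] /eqP-> [h0 h1 h3]; rewrite /bdeg /=; lia. Qed.

Lemma leq_coef c n d d' t : 0 < n -> d <= d' -> t <= c * n ^ d -> t <= c * n ^ d'.
Proof. by move=> n0 h /leq_trans; apply; rewrite leq_mul2l leq_pexp2l ?orbT. Qed.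

(** Stored values stay below [B] because assigned and written expressions cannot grow, and
    intermediate values stay below [B ^ maxesz p], so no step leaves the word range. The loop bounds
    are never written, so each loop contributes a factor known in advance. *)
Lemma compile_exec W B n p s :
  wf p -> 1 < B -> B <= W -> maxlit p < B -> B ^ maxesz p <= W ->
  bounded B s -> sizes_ok n s ->
  bounded B (run p s) /\
  exists2 t, exec W (compile p) s (run p s) t &
             0 < n -> t <= coef p * n ^ deg p.
Proof.
move=> + B1 BW; have B0 : 0 < B by lia.
elim: p s => [|r e|a i e|p1 IH1 p2 IH2|e p1 IH1 p2 IH2|r b p IH] s /= w hl hW hs hn.
- by split=> //; exists 1 => //; exact: ExecSkip.
- case/andP: w => _ ng; split; first by apply: bounded_set_reg => //; apply: nogrow_lt.
  exists (cost e).+1 => [|_]; last by rewrite expn0 muln1.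
  by apply: ExecAssign; apply: eval_fits hW.
- move: hl; rewrite gtn_max => /andP[hli hle].
  split.
    case: hs => hr ha; split=> //= a' i'; case: ifP => // _; exact: nogrow_lt.
  exists (cost i + cost e).+1 => [|_]; last by rewrite expn0 muln1.
  apply: ExecWrite; apply: (eval_fits B1 hs) => //; apply: leq_trans hW;
    by rewrite leq_exp2l // leq_max leqnn ?orbT.
- move: w hl; rewrite gtn_max => /andP[w1 w2] /andP[hl1 hl2].
  have [b1 [t1 e1 ht1]] : _ := IH1 s w1 hl1 (leq_trans (leq_pexp2l B0 (leq_maxl _ _)) hW) hs hn.
  have [b2 [t2 e2 ht2]] := IH2 _ w2 hl2 (leq_trans (leq_pexp2l B0 (leq_maxr _ _)) hW) b1 (sizes_run w1 hn).
  split=> //; exists (t1 + t2); first exact: ExecSeq e1 e2.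
  move=> n0; rewrite mulnDl leq_add //.
    by apply: leq_coef (ht1 n0); rewrite // leq_maxl.
  by apply: leq_coef (ht2 n0); rewrite // leq_maxr.
- move: w hl; rewrite !gtn_max => /andP[w1 w2] /and3P[hle hl1 hl2].
  have fe : fits W s e.
    apply: (eval_fits B1 hs hle); apply: leq_trans hW.
    by rewrite leq_exp2l // leq_maxl.
  have hW' : B ^ maxn (maxesz p1) (maxesz p2) <= W.
    by apply: leq_trans hW; rewrite leq_exp2l // leq_maxr.
  have [b1 [t1 e1 ht1]] := IH1 s w1 hl1 (leq_trans (leq_pexp2l B0 (leq_maxl _ _)) hW') hs hn.
  have [b2 [t2 e2 ht2]] := IH2 s w2 hl2 (leq_trans (leq_pexp2l B0 (leq_maxr _ _)) hW') hs hn.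
  have key c : 0 < n -> cost e + c * n ^ maxn (deg p1) (deg p2) <
      (cost e + c).+1 * n ^ maxn (deg p1) (deg p2).
    move=> n0; have : 0 < n ^ maxn (deg p1) (deg p2) by rewrite expn_gt0 n0.
    by move: (n ^ _) => N; nia.
  case: ifP => he; split=> //.
    exists (cost e + t1).+1 => [|n0]; first by apply: ExecIf; rewrite ?he.
    apply: leq_trans (key _ n0); rewrite ltnS leq_add2l mulnDl.
    by apply: leq_trans (leq_addr _ _); apply: leq_coef (ht1 n0); rewrite // leq_maxl.
  exists (cost e + t2).+1 => [|n0]; first by apply: ExecIf; rewrite ?he.
  apply: leq_trans (key _ n0); rewrite ltnS leq_add2l mulnDl.
  by apply: leq_trans (leq_addl _ _); apply: leq_coef (ht2 n0); rewrite // leq_maxr.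
- case/and4P: w => rb bb rp w.
  set N := reg s b; pose f i s' := set_reg (run p s') r i.+1.
  have NB : N < B by case: hs => h _; apply: h.
  have br : (b == r) = false by apply: contraNF rb => /eqP<-.
  pose st i := iteri i f (set_reg s r 0).
  have ok i : i <= N ->
      [/\ bounded B (st i), sizes_ok n (st i), reg (st i) r = i & reg (st i) b = N].
    elim: i => [|i IHi] hi.
      by split; [apply: bounded_set_reg | apply: sizes_set_reg | rewrite /= eqxx | rewrite /= br].
    have [bi ni ri Ni] := IHi (ltnW hi).
    have [bi' _] := IH _ w hl hW bi ni.
    split; [| |by rewrite /= eqxx |].
    + by apply: bounded_set_reg => //; lia.
    + by apply: sizes_set_reg => //; apply: sizes_run.
    + by rewrite /= br reg_run // wf_nwr.
  split; first by case: (ok N).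
  have fitsL i : i <= N -> fits W (st i) (loop_test r b).
    move=> hi; have [_ _ ri Ni] := ok i hi; rewrite /= ri Ni.
    by case: ltnP; lia.
  (* Induction on the number [j] of remaining iterations. The failing last test costs 4; an
     iteration costs 4 for its test and 4 for the increment besides its body. *)
  have loop j : j <= N -> exists2 t,
      exec W (While (loop_test r b) (Seq (compile p) (incr r))) (st (N - j)) (st N) t
      & 0 < n -> t <= 4 + j * (coef p * n ^ deg p + 8).
    elim: j => [|j IHj] hj.
      have [_ _ rN bN] := ok N (leqnn N).
      exists 4; last by lia.
      by rewrite subn0; apply: ExecWhileStop; rewrite ?fitsL //= rN bN ltnn.
    have [t' e' ht'] := IHj (ltnW hj).
    set i := N - j.+1; have iN : i < N by lia.
    have [bi ni ri Ni] := ok i (ltnW iN).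
    have [bi' [t ei ht]] := IH _ w hl hW bi ni.
    have E : st (N - j) = set_reg (run p (st i)) r i.+1.
      by rewrite (_ : N - j = i.+1) //; lia.
    exists (3 + (t + 4) + t').+1; last by move=> n0; move: (ht n0) (ht' n0); lia.
    apply: (ExecWhileStep (s2 := st (N - j))) e' => //; first exact: fitsL (ltnW iN).
    - by rewrite /= ri Ni iN.
    - apply: ExecSeq ei _; rewrite E.
      have ri' : reg (run p (st i)) r = i by rewrite reg_run.
      have := @ExecAssign W (run p (st i)) r (Bin Add (Reg r) (Lit 1)).
      by rewrite /= ri' addn1; apply; lia.
  have [t et ht] := loop N (leqnn N).
  exists (2 + t).
    apply: ExecSeq; first by apply: ExecAssign => /=; lia.
    by rewrite subnn in et.
  move=> n0; apply: leq_trans (leq_add (leqnn 2) (ht n0)) _.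
  have := sizes_iter bb hn; rewrite -/N.
  have h1 : 0 < n ^ bdeg b by rewrite expn_gt0 n0.
  have h2 : 0 < n ^ deg p by rewrite expn_gt0 n0.
  rewrite expnD; move: (n ^ bdeg b) (n ^ deg p) h1 h2 => X Y; nia.
Qed.

Arguments run : simpl never.

Lemma run_seq p q s : run (PSeq p q) s = run q (run p s). Proof. by []. Qed.

Lemma run_skip s : run PSkip s = s. Proof. by []. Qed.
Lemma run_asg r e s : run (PAsg r e) s = set_reg s r (eval s e). Proof. by []. Qed.
Lemma run_wr a i e s : run (PWr a i e) s = set_arr s a (eval s i) (eval s e).
Proof. by []. Qed.
Definition runE := (run_seq, run_skip, run_asg, run_wr).

(** The invariant rule for loops. [I i] describes the state at the start of iteration [i], so the
    step includes the advance of the counter. *)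
Lemma run_for (I : nat -> state -> Prop) r b p s N :
  reg s b = N -> nwr r p -> I 0 (set_reg s r 0) ->
  (forall i s', i < N -> reg s' r = i -> I i s' ->
     I i.+1 (set_reg (run p s') r i.+1)) ->
  I N (run (PFor r b p) s).
Proof.
move=> <- hr h0 hS.
suff: forall i, i <= reg s b -> I i (iteri i (fun i s' => set_reg (run p s') r i.+1) (set_reg s r 0)).
  exact.
elim=> [|i IH] hi //=; apply: hS => //; last by apply: IH; apply: ltnW.
by case: i hi {IH} => [|i] _ /=; rewrite eqxx.
Qed.

(** * Boolean tests and search loops *)

Definition eNot e := Bin Eq e (Lit 0).
(** Truth means being nonzero, so products and sums act as connectives. They are not [nogrow]; a
    truth value to be stored ends in a comparison, for instance through [eBool], which also
    normalizes it to 0 or 1. *)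
Definition eAnd e1 e2 := Bin Mul e1 e2.
Definition eOr e1 e2 := Bin Add e1 e2.
Definition eEq e1 e2 := Bin Eq e1 e2.
Definition eLt e1 e2 := Bin Lt e1 e2.
Definition eBool e := eNot (eNot e).

Definition test s e := eval s e != 0.

Lemma test_and s e1 e2 : test s (eAnd e1 e2) = test s e1 && test s e2.
Proof. by rewrite /test /= muln_eq0 negb_or. Qed.
Lemma test_or s e1 e2 : test s (eOr e1 e2) = test s e1 || test s e2.
Proof. by rewrite /test /= addn_eq0 negb_and. Qed.
Lemma test_not s e : test s (eNot e) = ~~ test s e.
Proof. by rewrite /test /=; case: (eval s e). Qed.
Lemma test_eq s e1 e2 : test s (eEq e1 e2) = (eval s e1 == eval s e2).
Proof. by rewrite /test /=; case: (eval s e1 == eval s e2). Qed.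
Lemma test_lt s e1 e2 : test s (eLt e1 e2) = (eval s e1 < eval s e2).
Proof. by rewrite /test /=; case: (eval s e1 < eval s e2). Qed.
Lemma eval_not s e : eval s (eNot e) = ~~ test s e :> nat.
Proof. by rewrite /test /= negbK. Qed.
Lemma eval_eq s e1 e2 : eval s (eEq e1 e2) = (eval s e1 == eval s e2) :> nat.
Proof. by []. Qed.
Lemma eval_bool s e : eval s (eBool e) = test s e :> nat.
Proof. by rewrite /eBool eval_not test_not negbK. Qed.
Lemma eval_neq0 s e : (eval s e != 0) = test s e. Proof. by []. Qed.

Definition testE := (test_and, test_or, test_not, test_eq, test_lt).

Lemma run_if e p q s : run (PIf e p q) s = if test s e then run p s else run q s.
Proof. by []. Qed.

Definition eMem (cs : seq nat) (e : expr) : expr :=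
  foldr (fun c => eOr (eEq e (Lit c))) (Lit 0) cs.

Lemma test_mem s cs e : test s (eMem cs e) = (eval s e \in cs).
Proof. by elim: cs => //= c cs IH; rewrite test_or test_eq IH inE. Qed.

(** What a loop leaves in a variable that it overwrites at every hit; both the choice of an
    uncolored vertex and the numbering of ends have this form. *)
Definition last_index (P : pred nat) (N d : nat) : nat :=
  iteri N (fun i a => if P i then i else a) d.

Lemma last_indexP (P : pred nat) N d i :
  i < N -> P i -> P (last_index P N d) /\ last_index P N d < N.
Proof.
elim: N => // N IH; rewrite ltnS leq_eqVlt /= => /orP[/eqP->|lt] Pi.
  by rewrite Pi.
by case: ifP => // _; case: (IH lt Pi) => ? ?; split=> //; apply: ltnW.
Qed.

Lemma last_index_none (P : pred nat) N d :
  (forall i, i < N -> ~~ P i) -> last_index P N d = d.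
Proof.
elim: N => //= N IH h; rewrite (negbTE (h N _)) // IH // => i hi.
by apply: h; apply: ltnW.
Qed.

Lemma eq_last_index (P P' : pred nat) N d :
  (forall i, i < N -> P i = P' i) -> last_index P N d = last_index P' N d.
Proof.
elim: N => // N IH h; rewrite /last_index /= h //; case: ifP => // _.
by apply: IH => i hi; apply: h; apply: ltnW.
Qed.

(** An existential quantifier over tuples of vertices, realized by nested loops that set the flag
    [r] to [c] at a hit; [holds] is its truth value. *)
Fixpoint scan (vs : seq nat) (e : expr) (r c : nat) : prog :=
  if vs is v :: vs' then PFor v 0 (scan vs' e r c)
  else PIf e (PAsg r (Lit c)) PSkip.

Fixpoint holds (vs : seq nat) (e : expr) (s : state) : bool :=
  if vs is v :: vs' then
    has (fun i => holds vs' e (set_reg s v i)) (iota 0 (reg s 0))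
  else test s e.

Fixpoint eregs (e : expr) : seq nat :=
  match e with
  | Lit _ => [::]
  | Reg r => [:: r]
  | Read _ i => eregs i
  | Bin _ e1 e2 => eregs e1 ++ eregs e2
  end.

Definition agree (X : seq nat) (s s' : state) : Prop :=
  (forall a i, arr s a i = arr s' a i) /\
  (forall r, r \notin X -> reg s r = reg s' r).

Lemma eval_agree X s s' e :
  agree X s s' -> all [predC X] (eregs e) -> eval s e = eval s' e.
Proof.
case=> ha hr; elim: e => //= [r|a i IH|o e1 IH1 e2 IH2].
- by rewrite andbT => /hr.
- by move=> /IH->.
- by rewrite all_cat => /andP[/IH1-> /IH2->].
Qed.

Lemma agree_set_reg X s s' v i :
  agree X s s' -> agree (filter (predC1 v) X) (set_reg s v i) (set_reg s' v i).
Proof.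
case=> ha hr; split=> //= r; case: eqVneq => // rv.
by rewrite mem_filter /= rv => /hr.
Qed.

(** The quantified registers are set before the test is evaluated, so their old values cannot
    matter. Register 0 bounds the quantifiers and must stay outside [X]. *)
Lemma holds_agree X vs e s s' :
  agree X s s' -> 0 \notin X -> all (fun x => (x \in vs) || (x \notin X)) (eregs e) ->
  holds vs e s = holds vs e s'.
Proof.
elim: vs X s s' => [|v vs IH] X s s' h X0 he /=.
  by rewrite /test (eval_agree h).
rewrite h.2 //; apply: eq_in_has => i _.
apply: IH (agree_set_reg v i h) _ _; first by rewrite mem_filter negb_and X0 orbT.
apply: sub_all he => x; rewrite inE mem_filter /= negb_and negbK.
by case: (x == v) => /=; rewrite ?orbT.
Qed.

Lemma nwr_scan x vs e r c : x \notin r :: vs -> nwr x (scan vs e r c).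
Proof.
elim: vs => [|v vs IH] /=; rewrite !inE ?orbF.
  by rewrite eq_sym => ->.
by rewrite !negb_or => /and3P[h1 h2 h3]; rewrite eq_sym h2 IH // inE negb_or h1.
Qed.

Lemma nwa_scan a vs e r c : nwa a (scan vs e r c).
Proof. by elim: vs. Qed.

Lemma iota_rcons i : iota 0 i.+1 = iota 0 i ++ [:: i].
Proof. by rewrite -addn1 iotaD. Qed.

(** The loops write only the flag and their counters, and the test does not read the flag; so every
    inner test sees the arrays and free registers of the initial state. *)
Lemma reg_scan vs e r c s :
  r \notin vs -> uniq vs -> 0 \notin r :: vs -> r \notin eregs e ->
  reg (run (scan vs e r c) s) r = if holds vs e s then c else reg s r.
Proof.
elim: vs s => [|v vs IH] s.
  move=> _ _ _ _; rewrite /= run_if; case: ifP => //= _.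
  by rewrite /run /= eqxx.
rewrite inE /= negb_or => /andP[rv rvs] /andP[vvs uvs].
rewrite !inE !negb_or => /and3P[r0 v0 vs0] re.
have r0' : 0 \notin r :: vs by rewrite inE negb_or r0.
pose I i s' := agree (r :: v :: vs) s' s /\
  reg s' r = if has (fun i => holds vs e (set_reg s v i)) (iota 0 i) then c else reg s r.
suff: I (reg s 0) (run (PFor v 0 (scan vs e r c)) s) by case.
apply: run_for => //; first by rewrite nwr_scan // inE negb_or eq_sym rv.
  split; last by rewrite /= (negbTE rv).
  by split=> //= x; rewrite !inE !negb_or => /and3P[_ /negbTE-> _].
move=> i s' _ hi [ag hr]; split.
  split=> [a j|x]; first by rewrite /= arr_run ?nwa_scan //; apply: ag.1.
  move=> hx; rewrite /=; case: eqP hx => [->|_ hx]; first by rewrite !inE eqxx orbT.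
  rewrite reg_run ?ag.2 //; apply: nwr_scan.
  by apply: contra hx; rewrite !inE => /orP[]->; rewrite ?orbT.
rewrite iota_rcons has_cat /= (negbTE rv) IH // orbF hr.
have -> : holds vs e s' = holds vs e (set_reg s v i).
  apply: (@holds_agree (r :: vs)) => //.
    split=> [a j|x hx] /=; first exact: ag.1.
    case: eqP => [->|/eqP xv] //; apply: ag.2.
    by move: hx; rewrite !inE !negb_or xv => /andP[-> ->].
  apply/allP=> x xe; rewrite inE; case: (x \in vs) => //=; rewrite orbF.
  by apply: contraNneq re => <-.
by case: (has _ _); case: (holds _ _ _).
Qed.

Definition seqs (ps : seq prog) : prog := foldr PSeq PSkip ps.

Lemma run_seqs_nil s : run (seqs [::]) s = s. Proof. by []. Qed.
Lemma run_seqs_cons p ps s : run (seqs (p :: ps)) s = run (seqs ps) (run p s).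
Proof. by []. Qed.
Definition run_seqsE := (run_seqs_cons, run_seqs_nil).

Lemma nwr_seqs r ps : nwr r (seqs ps) = all (nwr r) ps.
Proof. by elim: ps => //= p ps ->. Qed.
Lemma nwa_seqs a ps : nwa a (seqs ps) = all (nwa a) ps.
Proof. by elim: ps => //= p ps ->. Qed.
Lemma wf_seqs ps : wf (seqs ps) = all wf ps.
Proof. by elim: ps => //= p ps ->. Qed.
Lemma deg_seqs d ps : (deg (seqs ps) <= d) = all (fun p => deg p <= d) ps.
Proof. by elim: ps => //= p ps <-; rewrite geq_max. Qed.

(** * The algorithm *)

(* Registers: 0 is [n], 3 is [2 n], 5 a flag, 6 to 9 loop variables, 10 the
   root of the propagation. Arrays: 5 is the adjacency matrix of [G], 6 the
   coloring ([k] means uncolored), 7 the vertices to absorb, 8 and 9 the set of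
   reached vertices and the values of [x] on it, 10 and 11 the same for the
   components already solved. Matrices are stored by rows. *)
Definition eAt a i j := Read a (Bin Add (Bin Mul i (Reg 0)) j).
Definition eLink u v := eAnd (eAt 5 u v) (eNot (eEq (Read 6 u) (Read 6 v))).

Definition P_adj : prog :=
  PFor 6 1 (PSeq (PWr 5 (Bin Add (Bin Mul (Read 0 (Reg 6)) (Reg 0)) (Read 1 (Reg 6))) (Lit 1))
                 (PWr 5 (Bin Add (Bin Mul (Read 1 (Reg 6)) (Reg 0)) (Read 0 (Reg 6))) (Lit 1))).

(** The default [n] is not a vertex: when all vertices are colored, the write that follows hits the
    cell behind the last color and changes nothing relevant. *)
Definition P_pick k : prog :=
  PSeq (PAsg 5 (Reg 0))
       (PFor 6 0 (PIf (eEq (Read 6 (Reg 6)) (Lit k)) (PAsg 5 (Reg 6)) PSkip)).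

(** The strict order makes the three neighbors distinct. *)
Definition tri_test c : expr :=
  eAnd (eAnd (eLt (Reg 7) (Reg 8)) (eLt (Reg 8) (Reg 9)))
  (eAnd (eAnd (eAt 5 (Reg 6) (Reg 7)) (eAnd (eAt 5 (Reg 6) (Reg 8)) (eAt 5 (Reg 6) (Reg 9))))
        (eAnd (eEq (Read 6 (Reg 7)) (Lit c))
              (eAnd (eEq (Read 6 (Reg 8)) (Lit c)) (eEq (Read 6 (Reg 9)) (Lit c))))).

Definition P_mark c : prog :=
  PFor 6 0 (PSeq (PAsg 5 (Lit 0))
           (PSeq (scan [:: 7; 8; 9] (tri_test c) 5 1) (PWr 7 (Reg 6) (Reg 5)))).

(** Marking is finished before absorbing starts, so vertices absorbed in this step do not serve as
    witnesses for others. *)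
Definition P_absorb k c : prog :=
  PFor 6 0 (PIf (eAnd (eEq (Read 6 (Reg 6)) (Lit k)) (Read 7 (Reg 6)))
                (PWr 6 (Reg 6) (Lit c)) PSkip).

Definition P_step k c : prog :=
  seqs [:: P_pick k; PWr 6 (Reg 5) (Lit c); P_mark c; P_absorb k c].

Definition P_color k (g : seq nat) : prog :=
  PSeq (PFor 6 0 (PWr 6 (Reg 6) (Lit k))) (seqs [seq P_step k c | c <- g]).

(** For each color, membership in [cs] is the value of the first neighbor of the root with that
    color, and a later neighbor of the same color gets the opposite value. Equality with the negated
    flag computes the exclusive or. *)
Definition P_start (cs : seq nat) : prog :=
  PSeq (PFor 6 0 (PWr 8 (Reg 6) (eEq (Reg 6) (Reg 10))))
  (PFor 6 0 (PSeq (PAsg 5 (Lit 0))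
    (PSeq (scan [:: 7] (eAnd (eLt (Reg 7) (Reg 6)) (eAnd (eLink (Reg 10) (Reg 7))
               (eEq (Read 6 (Reg 7)) (Read 6 (Reg 6))))) 5 1)
          (PWr 9 (Bin Add (Bin Mul (Reg 10) (Reg 0)) (Reg 6))
                 (eEq (eNot (Reg 5)) (eBool (eMem cs (Read 6 (Reg 6))))))))).

(** With [v], [w] in registers 7 and 8, the end at which [v] meets [w] is normalized to value 0. A
    neighbor [u] of [v] lies at that end exactly when [u] is [w], or [u] is linked to [w] and meets
    it at the same end of [w] as [v] does. *)
Definition P_visit : prog :=
  PIf (eAnd (eNot (Read 8 (Reg 7))) (eAnd (Read 8 (Reg 8)) (eLink (Reg 7) (Reg 8))))
    (PSeq (PWr 8 (Reg 7) (Lit 1))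
       (PFor 9 0 (PWr 9 (Bin Add (Bin Mul (Reg 7) (Reg 0)) (Reg 9))
          (eNot (eOr (eEq (Reg 9) (Reg 8))
             (eAnd (eLink (Reg 8) (Reg 9))
                   (eEq (eBool (eAt 9 (Reg 8) (Reg 9))) (eBool (eAt 9 (Reg 8) (Reg 7))))))))))
    PSkip.

Definition P_round : prog := PFor 7 0 (PFor 8 0 P_visit).
Definition P_prop : prog := PFor 6 0 P_round.

(** A violation of the criterion at the vertex in register 6; comparing one side with the negation
    of the other tests that they differ. *)
Definition bad_test : expr :=
  eAnd (Read 8 (Reg 6)) (eAnd (eNot (eEq (Reg 7) (Reg 8)))
  (eAnd (eLink (Reg 6) (Reg 7)) (eAnd (eLink (Reg 6) (Reg 8))
  (eEq (eEq (eBool (eAt 9 (Reg 6) (Reg 7))) (eBool (eAt 9 (Reg 6) (Reg 8))))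
       (eNot (eAnd (eLink (Reg 7) (Reg 8))
          (eEq (eBool (eAt 9 (Reg 7) (Reg 6))) (eBool (eAt 9 (Reg 7) (Reg 8)))))))))).

Definition P_check : prog :=
  PSeq (PAsg 5 (Lit 1)) (scan [:: 6; 7; 8] bad_test 5 0).

Definition P_copy : prog :=
  PIf (Reg 5)
    (PFor 6 0 (PIf (Read 8 (Reg 6))
       (PSeq (PWr 10 (Reg 6) (Lit 1))
             (PFor 7 0 (PWr 11 (Bin Add (Bin Mul (Reg 6) (Reg 0)) (Reg 7)) (eAt 9 (Reg 6) (Reg 7)))))
       PSkip))
    PSkip.

Definition P_mask (cs : seq nat) : prog := seqs [:: P_start cs; P_prop; P_check; P_copy].

Fixpoint subs (s : seq nat) : seq (seq nat) :=
  if s is x :: s' then map (cons x) (subs s') ++ subs s' else [:: [::]].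

Definition P_root k : prog := seqs [seq P_mask cs | cs <- subs (iota 0 k)].

(** Every vertex serves as a root, also in a component solved before; a further success there
    replaces the rows of the whole component. *)
Definition P_lines k : prog :=
  PSeq (PFor 6 0 (PWr 10 (Reg 6) (Lit 0))) (PFor 10 0 (P_root k)).

(* A flag [f = 2 * u + t] stands for the end [t] of the edge [u] of [H]. *)
Definition rel_test (t : nat) : expr :=
  let f := Reg 7 in let u := Bin Div f (Lit 2) in
  eOr (eEq (Bin Add (Bin Mul (Lit 2) (Reg 6)) (Lit t)) f)
      (eAnd (eLink (Reg 6) u) (eAnd (eEq (eBool (eAt 11 (Reg 6) u)) (Lit t))
         (eEq (Bin Add (Bin Mul (Lit 2) u) (eBool (eAt 11 u (Reg 6)))) f))).

(** Each end is named by the largest flag identified with it. The other flags become isolated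
    vertices, so the output graph has [2 n] vertices and nothing is renumbered. *)
Definition P_out : prog :=
  seqs [:: PFor 6 0 (seqs [:: PWr 4 (Reg 6) (Read 6 (Reg 6));
                 PWr 2 (Reg 6) (Lit 0); PWr 3 (Reg 6) (Lit 0);
                 PFor 7 3 (PSeq (PIf (rel_test 0) (PWr 2 (Reg 6) (Reg 7)) PSkip)
                                (PIf (rel_test 1) (PWr 3 (Reg 6) (Reg 7)) PSkip))]);
           PAsg 4 (Reg 0); PAsg 2 (Lit 1)].

(** The guesses are not trusted: acceptance requires that every vertex is solved and colored and
    that the color classes are cliques. *)
Definition P_final k : prog :=
  seqs [:: PAsg 5 (Lit 1);
    scan [:: 6] (eNot (eAnd (Read 10 (Reg 6)) (eLt (Read 6 (Reg 6)) (Lit k)))) 5 0;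
    scan [:: 6; 7] (eAnd (eNot (eEq (Reg 6) (Reg 7)))
        (eAnd (eEq (Read 6 (Reg 6)) (Read 6 (Reg 7))) (eNot (eAt 5 (Reg 6) (Reg 7))))) 5 0;
    PIf (Reg 5) P_out PSkip].

(** After a success later guesses are skipped, which preserves the output. *)
Definition P_try k g : prog :=
  PIf (Reg 2) PSkip (seqs [:: P_color k g; P_lines k; P_final k]).

Fixpoint strings (k d : nat) : seq (seq nat) :=
  if d is d'.+1 then [seq c :: g | c <- iota 0 k, g <- strings k d'] else [:: [::]].

Lemma mem_strings k d g : (g \in strings k d) = (size g == d) && all (gtn k) g.
Proof.
elim: d g => [|d IH] [|c g] //; first by apply/negP => /allpairsP[[? ?] []].
apply/allpairsP/idP => [[[c' g'] /= [hc hg [-> ->]]]|/= /and3P[hg hc ha]].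
  by move: hg hc; rewrite IH mem_iota add0n eqSS /= => /andP[-> ->] ->.
by exists (c, g); rewrite /= mem_iota IH -eqSS hg.
Qed.

Definition P_main k : prog :=
  PSeq P_adj (seqs [seq P_try k g | g <- strings k (3 * k)]).

Lemma wf_main k : wf (P_main k).
Proof.
rewrite /P_main /= wf_seqs all_map; apply/allP=> g _ /=.
rewrite !wf_seqs !nwr_seqs !all_map /=.
by rewrite !andbT; apply/and3P; split; apply/allP.
Qed.

(** The strings and subsets are unrolled in the program text, so their number enters only the
    coefficient. The value 6 is [k + 5] at [k = 1], the smallest exponent that has to be met. *)
Lemma deg_main k : deg (P_main k) <= 6.
Proof.
rewrite /P_main /= geq_max /= deg_seqs all_map; apply/allP=> g _ /=.
rewrite /P_try /= !geq_max /=.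
rewrite (deg_seqs 6) all_map [X in X && _](_ : _ = true) /=; last by apply/allP.
rewrite /bdeg /= andbT -[6]/(1 + 5) leq_add2l (deg_seqs 5) all_map.
exact/allP.
Qed.

(** * Guessing the color classes *)

Section Coloring.
Variables (n k : nat) (A : nat -> nat -> bool).

Definition bit (s : state) (a i j : nat) : bool := arr s a (i * n + j) != 0.

Definition input_ok (s : state) : Prop :=
  [/\ reg s 0 = n, reg s 3 = n + n & forall i j, i < n -> j < n -> bit s 5 i j = A i j].

Lemma input_run p s :
  nwr 0 p -> nwr 3 p -> nwa 5 p -> input_ok s -> input_ok (run p s).
Proof.
move=> h0 h3 h5 [e0 e3 e5]; split; rewrite ?reg_run // => i j hi hj.
by rewrite /bit arr_run // -e5.
Qed.

Lemma input_set_reg r v s : r != 0 -> r != 3 -> input_ok s -> input_ok (set_reg s r v).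
Proof.
by rewrite eq_sym [r == 3]eq_sym => /negbTE h0 /negbTE h3 [e0 e3 e5]; split; rewrite /= ?h0 ?h3.
Qed.

Lemma test_at s a e1 e2 : reg s 0 = n ->
  test s (eAt a e1 e2) = bit s a (eval s e1) (eval s e2).
Proof. by move=> h; rewrite /test /= h. Qed.

Definition uncolored (col : nat -> nat) : nat := last_index (fun v => col v == k) n n.

Definition tri (col : nat -> nat) (c u : nat) : bool :=
  has (fun x => has (fun y => has (fun z =>
    ((x < y) && (y < z)) && ((A u x && (A u y && A u z)) &&
    ((col x == c) && ((col y == c) && (col z == c))))) (iota 0 n)) (iota 0 n)) (iota 0 n).

Definition recolor (col : nat -> nat) (c u : nat) : nat :=
  if u == uncolored col then c else col u.

(** The effect of one [P_step] on the colors: both tests read the coloring after the guess and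
    before any absorption. *)
Definition color_next (col : nat -> nat) (c u : nat) : nat :=
  if (recolor col c u == k) && tri (recolor col c) c u then c else recolor col c u.

(** Colors are compared only below [n], since the cell behind them may have been overwritten. *)
Lemma eq_tri col col' c u :
  (forall v, v < n -> col v = col' v) -> tri col c u = tri col' c u.
Proof.
move=> h; apply: eq_in_has => x; rewrite mem_iota add0n /= => hx.
apply: eq_in_has => y; rewrite mem_iota add0n /= => hy.
by apply: eq_in_has => z; rewrite mem_iota add0n /= => hz; rewrite !h.
Qed.

Lemma eq_recolor col col' c u :
  (forall v, v < n -> col v = col' v) -> u < n -> recolor col c u = recolor col' c u.
Proof.
move=> h hu; rewrite /recolor /uncolored (@eq_last_index _ (fun v => col' v == k)).
  by rewrite h.
by move=> i hi; rewrite h.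
Qed.

Lemma eq_next col col' c u :
  (forall v, v < n -> col v = col' v) -> u < n -> color_next col c u = color_next col' c u.
Proof.
move=> h hu; rewrite /color_next (eq_recolor c h) // (@eq_tri _ (recolor col' c)) // => v.
exact: eq_recolor.
Qed.

Lemma reg_pick s : input_ok s -> reg (run (P_pick k) s) 5 = uncolored (arr s 6).
Proof.
case=> e0 _ _; rewrite /P_pick run_seq.
set s1 := run _ s.
pose I i s' := [/\ forall a j, arr s' a j = arr s a j
  & reg s' 5 = last_index (fun v => arr s 6 v == k) i n].
have E0 : reg s1 0 = n by rewrite reg_run.
have E5 : reg s1 5 = n by rewrite /s1 /run.
suff [] : I n (run (PFor 6 0 (PIf (eEq (Read 6 (Reg 6)) (Lit k)) (PAsg 5 (Reg 6)) PSkip)) s1) by [].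
apply: run_for => //.
move=> i s' hi ri [ha h5]; rewrite run_if testE /= !runE /= ri ha.
by case: ifP => E; split=> //=; rewrite E.

Qed.

Lemma mark_spec c s u : input_ok s -> u < n ->
  (arr (run (P_mark c) s) 7 u != 0) = tri (arr s 6) c u.
Proof.
move=> hs hu.
pose I i s' := [/\ input_ok s', forall j, arr s' 6 j = arr s 6 j &
  forall u, u < i -> (arr s' 7 u != 0) = tri (arr s 6) c u].
suff [_ _ H] : I n (run (P_mark c) s) by exact: H.
apply: run_for; [by case: hs | by [] | by split=> //; apply: input_set_reg |].
move=> i s' hi ri [is' h6 h7]; rewrite !run_seq.
set s1 := run (PAsg _ _) s'.
have [i1 r5 r6 a6] : [/\ input_ok s1, reg s1 5 = 0, reg s1 6 = i &
    forall j, arr s1 6 j = arr s 6 j] by split=> //; apply: input_run.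
have a7 j : arr s1 7 j = arr s' 7 j by [].
clearbody s1; set s2 := run (scan _ _ _ _) s1.
have [e0 _ e5] := i1.
have E5 : reg s2 5 = tri (arr s 6) c i.
  rewrite reg_scan // r5.
  rewrite [holds _ _ _](_ : _ = tri (arr s 6) c i); first by case: (tri _ _ _).
  rewrite /tri /= e0; apply: eq_in_has => x; rewrite mem_iota add0n /= => hx.
  apply: eq_in_has => y; rewrite mem_iota add0n /= => hy.
  apply: eq_in_has => z; rewrite mem_iota add0n /= => hz.
  by rewrite /tri_test !testE !test_at //= r6 !a6 -!e5.
have i2 : input_ok s2 by apply: input_run.
have h26 j : arr s2 6 j = arr s 6 j by rewrite arr_run.
have E6 : reg s2 6 = i by rewrite reg_run.
split; first by apply: input_set_reg => //; apply: input_run.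
  by move=> j; rewrite /= arr_run.
move=> v; rewrite ltnS /run /= E6 E5 => hv.
case: (eqVneq v i) => [->|vi]; first by case: tri.
by rewrite arr_run // a7; apply: h7; lia.
Qed.

Lemma absorb_spec c s u : input_ok s -> u < n ->
  arr (run (P_absorb k c) s) 6 u =
  if (arr s 6 u == k) && (arr s 7 u != 0) then c else arr s 6 u.
Proof.
move=> hs hu.
pose I i s' := (forall j, arr s' 7 j = arr s 7 j) /\ forall u, arr s' 6 u =
  if [&& u < i, arr s 6 u == k & arr s 7 u != 0] then c else arr s 6 u.
suff [_ H] : I n (run (P_absorb k c) s) by rewrite H hu.
apply: run_for => //; first by case: hs.
move=> i s' hi ri [h7 h6]; rewrite run_if testE !testE /test /= !runE /= ri h7 h6 ltnn /=.
case: ifP => E; split=> //= v; rewrite h6 [v < i.+1]ltnS [v <= i]leq_eqVlt;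
  by case: (eqVneq v i) => [->|_] /=; rewrite ?E ?ltnn.
Qed.

Lemma step_spec c s u : input_ok s -> u < n ->
  arr (run (P_step k c) s) 6 u = color_next (arr s 6) c u.
Proof.
move=> hs hu; rewrite /P_step !run_seqsE run_wr.
set s1 := run _ s; set s2 := set_arr _ _ _ _; set s3 := run (P_mark c) s2.
have i2 : input_ok s2 by apply: (@input_run (PSeq (P_pick k) (PWr 6 (Reg 5) (Lit c)))).
have a2 v : arr s2 6 v = recolor (arr s 6) c v.
  by rewrite /= reg_pick // /recolor arr_run.
have i3 : input_ok s3 by apply: input_run.
rewrite absorb_spec // mark_spec // arr_run // a2 /color_next (@eq_tri _ (recolor (arr s 6) c)) //.
Qed.

Lemma steps_spec g s col u :
  input_ok s -> (forall v, v < n -> arr s 6 v = col v) -> u < n ->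
  arr (run (seqs [seq P_step k c | c <- g]) s) 6 u = foldl color_next col g u.
Proof.
elim: g s col => [|c g IH] s col hs h hu //=; first exact: h.
rewrite run_seq; apply: IH => //; first exact: input_run.
by move=> v hv; rewrite step_spec //; apply: eq_next.
Qed.

Lemma color_spec g s u : input_ok s -> u < n ->
  arr (run (P_color k g) s) 6 u = foldl color_next (fun=> k) g u.
Proof.
move=> hs hu; rewrite /P_color run_seq; apply: steps_spec => //.
  exact: input_run.
pose I i s' := forall v, v < i -> arr s' 6 v = k.
apply: (@run_for I) => //; first by case: hs.
move=> i s' hi ri h v; rewrite ltnS leq_eqVlt !runE /= ri.
by case: eqVneq => //= _; apply: h.
Qed.

(** * Existence of a correct string of guesses *)

Section Complete.
Variable q : nat -> nat.
Hypothesis q_lt : forall v, v < n -> q v < k.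
Hypothesis q_clique : forall u v, u < n -> v < n -> u != v -> q u = q v -> A u v.
Hypothesis q_three : forall v x y z, v < n -> x < n -> y < n -> z < n ->
  x < y -> y < z -> A v x -> A v y -> A v z -> q y = q x -> q z = q x -> q v = q x.

Definition cnt (col : nat -> nat) c := count (fun v => col v == c) (iota 0 n).

(** The invariant of a run with correct guesses: no vertex is colored wrongly, and a class is
    complete as soon as three of its vertices are colored. *)
Definition col_ok (col : nat -> nat) : Prop :=
  (forall v, v < n -> col v = k \/ col v = q v) /\
  (forall c, c < k -> cnt col c <= 2 \/ forall v, v < n -> q v = c -> col v = c).

Lemma count_three (P : pred nat) : 2 < count P (iota 0 n) ->
  exists x y z, [/\ x < y, y < z, z < n & [/\ P x, P y & P z]].
Proof.
rewrite -size_filter; have : all (fun v => (v < n) && P v) (filter P (iota 0 n)).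
  by apply/allP=> v; rewrite mem_filter mem_iota add0n /= andbC.
have : sorted ltn (filter P (iota 0 n)).
  by apply: sorted_filter; [exact: ltn_trans | exact: iota_ltn_sorted].
case: filter => [|x [|y [|z s]]] //= /and3P[xy yz _] /and4P[/andP[hx Px] /andP[hy Py] /andP[hz Pz] _] _.
by exists x, y, z.
Qed.

Lemma three_count (P : pred nat) x y z :
  x < y -> y < z -> z < n -> P x -> P y -> P z -> 2 < count P (iota 0 n).
Proof.
move=> xy yz zn Px Py Pz; rewrite -size_filter.
apply: (@uniq_leq_size _ [:: x; y; z]).
  by rewrite /= !inE !negb_or; lia.
move=> v; rewrite !inE mem_filter mem_iota => /or3P[] /eqP->; rewrite ?Px ?Py ?Pz; lia.
Qed.

Lemma triP col c u : reflect (exists x y z, [/\ x < y, y < z, z < n,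
   [/\ A u x, A u y & A u z] & [/\ col x = c, col y = c & col z = c]]) (tri col c u).
Proof.
apply: (iffP hasP) => [[x hx /hasP[y hy /hasP[z hz]]]|[x [y [z]]]].
  case/andP=> /andP[xy yz] /andP[/and3P[ux uy uz] /and3P[/eqP cx /eqP cy /eqP cz]].
  by exists x, y, z; split=> //; move: hz; rewrite mem_iota.
case=> xy yz zn [ux uy uz] [cx cy cz].
exists x; first by rewrite mem_iota; lia.
apply/hasP; exists y; first by rewrite mem_iota; lia.
apply/hasP; exists z; first by rewrite mem_iota; lia.
by rewrite xy yz ux uy uz cx cy cz eqxx.
Qed.

Lemma leq_cnt col col' c : (forall v, v < n -> col v = c -> col' v = c) ->
  cnt col c <= cnt col' c.
Proof.
move=> h; rewrite /cnt -!size_filter; apply: uniq_leq_size.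
  by rewrite filter_uniq // iota_uniq.
move=> v; rewrite !mem_filter mem_iota add0n => /andP[/eqP hv /= vn].
by rewrite vn (h v) ?eqxx.
Qed.

Lemma ltn_cnt col col' c u : (forall v, v < n -> col v = c -> col' v = c) ->
  u < n -> col' u = c -> col u <> c -> cnt col c < cnt col' c.
Proof.
move=> h hu cu' cu; rewrite /cnt -!size_filter.
apply: (@uniq_leq_size _ (u :: filter (fun v => col v == c) (iota 0 n))).
  by rewrite /= mem_filter filter_uniq ?iota_uniq //; move/eqP/negbTE: cu => ->.
move=> v; rewrite inE !mem_filter mem_iota add0n => /orP[/eqP->|/andP[/eqP hv /= vn]].
  by rewrite cu' eqxx.
by rewrite vn (h v) ?eqxx.
Qed.

Lemma next_full col c u : (forall v, v < n -> col v <> k) -> u < n ->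
  color_next col c u = col u.
Proof.
move=> h hu; have E : recolor col c u = col u.
  rewrite /recolor /uncolored last_index_none; last by move=> i hi; apply/eqP; apply: h.
  by case: eqP => // E; move: hu; rewrite E ltnn.
by rewrite /color_next E; case: eqP => // /(h _ hu).
Qed.

(** The guess is the true color of the chosen vertex. Its class is incomplete, hence has at most two
    colored vertices, and gains one; if this is the third, absorption completes the class. *)
Lemma next_ok col v : col_ok col -> v < n -> col v = k ->
  let col' := color_next col (q (uncolored col)) in
  [/\ q (uncolored col) < k, col_ok col', forall c, c < k -> cnt col c <= cnt col' c &
      exists2 c, c < k & cnt col c <= 2 /\ cnt col c < cnt col' c].
Proof.
move=> [ag inv] vn vk; set p := uncolored col; set c := q p => col'.
have [/eqP pk pn] : col p == k /\ p < n.
  by apply: (@last_indexP (fun v => col v == k) n n v) => //; apply/eqP.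
have ck : c < k by apply: q_lt.
pose col1 := recolor col c.
have c1p : col1 p = c by rewrite /col1 /recolor eqxx.
have ag1 u : u < n -> col1 u = k \/ col1 u = q u.
  by move=> un; rewrite /col1 /recolor -/p; case: eqP => [->|_]; [right | apply: ag].
have keep1 u d : d < k -> col u = d -> col1 u = d.
  move=> dk Ed; rewrite /col1 /recolor -/p; case: eqP => // E; move: dk.
  by rewrite -Ed E pk ltnn.
have keep u d : d < k -> col1 u = d -> col' u = d.
  move=> dk E; rewrite /col' /color_next -/c -/col1 E; case: eqP => //; lia.
have new u : col' u = c \/ col' u = col u.
  rewrite /col' /color_next -/c -/col1; case: ifP => _; first by left.
  by rewrite /col1 /recolor; case: ifP => _; [left | right].
(* The three witnesses of an absorption really belong to class [c], so [q_three] puts the absorbed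
   vertex there too. *)
have ag' u : u < n -> col' u = k \/ col' u = q u.
  move=> un; rewrite /col' /color_next -/c -/col1; case: ifP => [/andP[_ /triP]|_]; last exact: ag1.
  case=> x [y [z [xy yz zn [ux uy uz] [cx cy cz]]]]; right.
  have Q t : t < n -> col1 t = c -> q t = c.
    by move=> tn E; case: (ag1 t tn) => [F|<-] //; lia.
  have [Qx Qy Qz] : [/\ q x = c, q y = c & q z = c] by split; apply: Q => //; lia.
  by rewrite -Qx; apply/esym/(@q_three u x y z) => //; lia.
have c2 : cnt col c <= 2.
  by case: (inv c ck) => // /(_ p pn erefl); lia.
split=> //.
- split=> // d dk; case: (eqVneq d c) => [->|dc].
    case: (leqP (cnt col1 c) 2) => c1.
      (* With at most two vertices of color [c] nothing is absorbed. *)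
      left; apply: (leq_trans _ c1); apply: leq_cnt => u un.
      rewrite /col' /color_next -/c -/col1; case: ifP => // /andP[_ /triP].
      case=> x [y [z [xy yz zn [ux uy uz] [cx cy cz]]]] _.
      have h : 2 < cnt col1 c by apply: three_count xy yz zn _ _ _; apply/eqP.
      by rewrite ltnNge c1 in h.
    (* Three colored members of the clique are neighbors of each uncolored member, which is
       therefore absorbed. *)
    right=> u un qu; case: (ag1 u un) => [E|E]; last by apply: keep; rewrite // E.
    rewrite /col' /color_next -/c -/col1 E eqxx /=; case: triP => // - [].
    have [x [y [z [xy yz zn [/eqP cx /eqP cy /eqP cz]]]]] := count_three c1.
    have Q t : t < n -> col1 t = c -> A u t.
      move=> tn F; apply: q_clique => //; first by apply: contraTneq dk => G; move: E; rewrite G; lia.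
      by rewrite qu; case: (ag1 t tn) => //; lia.
    exists x, y, z; split=> //; split; apply: Q => //; lia.
  case: (inv d dk) => h; [left | right].
    apply: leq_trans h; apply: leq_cnt => u un; case: (new u) => -> // E.
    by rewrite E eqxx in dc.
  by move=> u un qu; apply: keep => //; apply: keep1 => //; apply: h.
- move=> d dk; apply: leq_cnt => u un E; apply: keep => //; exact: keep1.
- exists c => //; split=> //; apply: (@ltn_cnt _ _ _ p) => //.
  + by move=> u un E; apply: keep => //; apply: keep1.
  + exact: keep.
  + by rewrite pk; lia.
Qed.

(** The potential [Psi] counts at most three colored vertices per class. A correct guess raises it
    while an uncolored vertex remains, so [3 * k] guesses suffice. *)
Lemma coloring_complete : 0 < k -> exists2 g, g \in strings k (3 * k) &
  forall v, v < n -> foldl color_next (fun=> k) g v = q v.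
Proof.
move=> k0; pose Psi col := \sum_(c < k) minn 3 (cnt col c).
have H d : exists2 g, g \in strings k d & let col := foldl color_next (fun=> k) g in
    col_ok col /\ ((forall v, v < n -> col v <> k) \/ d <= Psi col).
  elim: d => [|d [g hg [ok h]]].
    exists [::] => //; split; last by right.
    split=> [v vn|c ck]; first by left.
    by left; rewrite /cnt (@eq_count _ _ pred0) ?count_pred0 // => v /=; apply/eqP; lia.
  have str c : c < k -> rcons g c \in strings k d.+1.
    by move: hg; rewrite !mem_strings size_rcons all_rcons /= eqSS => /andP[-> ->] ->.
  set col := foldl _ _ g in ok h *.
  case: (boolP (has (fun v => col v == k) (iota 0 n))) => [/hasP[v]|/hasPn none].
    rewrite mem_iota add0n /= => vn /eqP vk.
    have [ck ok' mono [c cl [c2 c3]]] := next_ok ok vn vk.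
    exists (rcons g (q (uncolored col))); first exact: str.
    rewrite -cats1 foldl_cat /= -/col; split=> //; right.
    case: h => [/(_ v vn)|h] //; apply: leq_ltn_trans h _.
    rewrite /Psi (bigD1 (Ordinal cl)) //= [X in _ < X](bigD1 (Ordinal cl)) //=.
    rewrite -addSn leq_add //; first by lia.
    by apply: leq_sum => i _; have := mono i (ltn_ord i); lia.
  have full v : v < n -> col v <> k.
    by move=> vn /eqP E; move: (none v); rewrite mem_iota add0n vn E => /(_ isT).
  (* Once everything is colored, the string is padded with color 0, which has no effect. *)
  exists (rcons g 0); first exact: str.
  rewrite -cats1 foldl_cat /= -/col.
  have E v : v < n -> color_next col 0 v = col v by move=> vn; apply: next_full.
  split; last by left=> v vn; rewrite E //; apply: full.
  case: ok => h1 h2; split=> [v vn|c ck]; first by rewrite E //; apply: h1.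
  case: (h2 c ck) => h3; [left | right].
    by apply: leq_trans h3; apply: leq_cnt => v vn; rewrite E.
  by move=> v vn /h3; rewrite E //; apply.
have [g hg [[h1 h2] h3]] := H (3 * k); exists g => // v vn.
set col := foldl _ _ g in h1 h2 h3 *.
case: h3 => [/(_ v vn)|h3]; first by case: (h1 v vn).
case: (h1 v vn) => // vk.
case: (h2 (q v) (q_lt vn)) => [h|]; last exact.
(* The class of an uncolored vertex contributes at most two. *)
have : Psi col < 3 * k.
  rewrite /Psi (bigD1 (Ordinal (q_lt vn))) //=.
  apply: (@leq_ltn_trans (2 + \sum_(i < k | i != Ordinal (q_lt vn)) 3)).
    by apply: leq_add; [lia | apply: leq_sum => i _; lia].
  rewrite sum_nat_const cardC1 card_ord; lia.
by lia.
Qed.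
End Complete.
End Coloring.

(** * Solving for the ends *)

Section Lines.
Variables (n k : nat) (A : nat -> nat -> bool) (col : nat -> nat).

Local Notation bitn := (bit n).

(** Adjacency in the graph [L], from which the edges inside color classes have been removed. *)
Definition link u v : bool := A u v && (col u != col v).

Hypothesis A_sym : forall u v, u < n -> v < n -> A u v = A v u.

Lemma link_sym u v : u < n -> v < n -> link u v = link v u.
Proof. by move=> hu hv; rewrite /link A_sym // eq_sym. Qed.

(* [x v u] is the end of the edge [v] at which it meets the edge [u]. *)
Definition consistent_at (x : nat -> nat -> bool) (v : nat) : Prop :=
  forall u w, u < n -> w < n -> u != w -> link v u -> link v w ->
    (x v u == x v w) = link u w && (x u v == x u w).

Definition consistent x := forall v, v < n -> consistent_at x v.

Definition colored (s : state) : Prop :=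
  input_ok n A s /\ forall u, u < n -> arr s 6 u = col u.

Lemma colored_run p s :
  nwr 0 p -> nwr 3 p -> nwa 5 p -> nwa 6 p -> colored s -> colored (run p s).
Proof.
move=> h0 h3 h5 h6 [i h]; split=> [|u hu]; first exact: input_run.
by rewrite arr_run // h.
Qed.

Lemma colored_set_reg r v s : r != 0 -> r != 3 -> colored s -> colored (set_reg s r v).
Proof. by move=> h0 h3 [i h]; split=> //; apply: input_set_reg. Qed.

Lemma colored0 s : colored s -> reg s 0 = n. Proof. by case=> -[]. Qed.

Lemma test_link s e1 e2 : colored s -> eval s e1 < n -> eval s e2 < n ->
  test s (eLink e1 e2) = link (eval s e1) (eval s e2).
Proof.
case=> -[e0 _ e5] e6 h1 h2; rewrite /eLink !testE (test_at _ _ _ e0) e5 //.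
by rewrite /link /= !e6.
Qed.

Lemma eqn_idx i j i' j' : j < n -> j' < n ->
  (i * n + j == i' * n + j') = (i == i') && (j == j').
Proof.
move=> hj hj'; apply/eqP/andP => [E|[/eqP-> /eqP->]] //.
have n0 : 0 < n by lia.
have := congr1 (divn^~ n) E; rewrite !divnMDl // !divn_small // !addn0 => Ei.
by move: E; rewrite Ei => /addnI->; rewrite !eqxx.
Qed.

Definition known (s : state) v : bool := arr s 8 v != 0.

Lemma known_run p s v : nwa 8 p -> known (run p s) v = known s v.
Proof. by move=> h; rewrite /known arr_run. Qed.

Lemma bit_run a p s i j : nwa a p -> bitn (run p s) a i j = bitn s a i j.
Proof. by move=> h; rewrite /bit arr_run. Qed.

Lemma start_known s r v : colored s -> reg s 10 = r -> v < n ->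
  known (run (PFor 6 0 (PWr 8 (Reg 6) (eEq (Reg 6) (Reg 10)))) s) v = (v == r).
Proof.
move=> hs hr hv.
pose I i s' := reg s' 10 = r /\ forall v, v < i -> known s' v = (v == r).
suff [_ H] : I n (run (PFor 6 0 (PWr 8 (Reg 6) (eEq (Reg 6) (Reg 10)))) s) by apply: H.
apply: run_for => //; first exact: colored0.
move=> i s' hi ri [h10 h]; split; first by [].
move=> u; rewrite ltnS leq_eqVlt /known !runE /= ri h10.
by case: (eqVneq u i) => [->|_] /=; [case: (i == r) | apply: h].
Qed.

Definition mask_split (cs : seq nat) (r u : nat) : bool :=
  has (fun w => [&& w < u, link r w & col w == col u]) (iota 0 n) (+) (col u \in cs).

Lemma start_spec cs s r : colored s -> reg s 10 = r -> r < n ->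
  let s' := run (P_start cs) s in
  (forall v, v < n -> known s' v = (v == r)) /\
  (forall u, u < n -> bitn s' 9 r u = mask_split cs r u).
Proof.
move=> hs hr rn; rewrite /P_start run_seq.
set s1 := run (PFor 6 0 _) s.
have [c1 r1 k1] : [/\ colored s1, reg s1 10 = r & forall v, v < n -> known s1 v = (v == r)].
  split; [exact: colored_run | by rewrite reg_run | by move=> v vn; apply: start_known].
clearbody s1 => {s hs hr}.
split=> [v vn|]; first by rewrite known_run // k1.
pose I i s' := [/\ colored s', reg s' 10 = r &
  forall u, u < i -> bitn s' 9 r u = mask_split cs r u].
set p := PFor _ _ _; suff [_ _ H] : I n (run p s1) by exact: H.
apply: run_for => //; first exact: colored0.
move=> i s' hi ri [cs' r' h]; rewrite !run_seq.
set s2 := run (PAsg _ _) s'.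
have [c2 r2 i2 f2] : [/\ colored s2, reg s2 10 = r, reg s2 6 = i & reg s2 5 = 0].
  by split=> //; apply: colored_run.
have a2 j : arr s2 9 j = arr s' 9 j by [].
clearbody s2; set s3 := run (scan _ _ _ _) s2.
have E5 : reg s3 5 = has (fun w => [&& w < i, link r w & col w == col i]) (iota 0 n).
  rewrite reg_scan // f2.
  rewrite [holds _ _ _](_ : _ = has (fun w => [&& w < i, link r w & col w == col i]) (iota 0 n)).
    by case: has.
  rewrite /= (colored0 c2); apply: eq_in_has => w; rewrite mem_iota add0n /= => wn.
  rewrite test_and test_lt test_and test_link ?test_eq /= ?i2 ?r2 //; first by rewrite !c2.2.
have [c3 r3 i3] : [/\ colored s3, reg s3 10 = r & reg s3 6 = i].
  by split; rewrite ?reg_run //; apply: colored_run.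
have a3 j : arr s3 9 j = arr s' 9 j by rewrite arr_run.
clearbody s3; split; first by apply: colored_set_reg => //; apply: colored_run.
  by [].
move=> u; rewrite ltnS leq_eqVlt /bit run_wr /= r3 (colored0 c3) i3.
case: (eqVneq u i) => [->|ui] /= ui'; last first.
  by rewrite eqn_idx ?eqxx ?(negbTE ui) //=; [rewrite a3; apply: h | lia].
rewrite eqxx /mask_split.
have -> : (eval s3 (eMem cs (Read 6 (Reg 6))) == 0) = (col i \notin cs).
  by rewrite -[LHS]negbK eval_neq0 test_mem /= i3 c3.2.
by rewrite E5; case: has; case: (_ \in _).
Qed.

(** The subset consists of the colors whose first neighbor of [r], given by [f], has value true.
    Another neighbor of the same color is not linked to it, so consistency at [r] forces the
    opposite value. *)
Lemma split_complete x r : r < n -> (forall v, v < n -> col v < k) -> consistent x ->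
  exists2 cs, cs \in subs (iota 0 k) & forall u, u < n -> link r u -> mask_split cs r u = x r u.
Proof.
move=> rn colk hx.
pose f c := find (fun u => link r u && (col u == c)) (iota 0 n).
exists (filter (fun c => x r (f c)) (iota 0 k)).
  elim: (iota 0 k) => //= c s IH; case: ifP => _; rewrite mem_cat ?IH ?orbT //.
  by rewrite map_f.
move=> u un ru; rewrite /mask_split mem_filter mem_iota add0n colk // andbT.
have hf : has (fun w => link r w && (col w == col u)) (iota 0 n).
  by apply/hasP; exists u; rewrite ?mem_iota // ru eqxx.
have fn : f (col u) < n by move: hf; rewrite has_find size_iota.
have /andP[Lf /eqP cf] : link r (f (col u)) && (col (f (col u)) == col u).
  by have := nth_find 0 hf; rewrite nth_iota.
have fmin w : w < f (col u) -> ~~ (link r w && (col w == col u)).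
  move=> wf; have := before_find 0 wf; rewrite nth_iota; last by lia.
  by rewrite add0n => ->.
case: (boolP (has _ _)) => [/hasP[w]|/hasPn none].
  rewrite mem_iota add0n /= => wn /and3P[wu rw /eqP cw].
  have fu : f (col u) != u.
    apply: contraTneq wu => E; rewrite -leqNgt -{}E leqNgt; apply/negP => /fmin.
    by rewrite rw cw eqxx.
  have := hx r rn _ _ fn un fu Lf ru; rewrite /link cf eqxx andbF /=.
  by case: (x r u); case: (x r (f _)).
suff -> : f (col u) = u by rewrite /= ?andbT.
apply/eqP; rewrite eqn_leq; apply/andP; split; rewrite leqNgt; apply/negP.
  by move=> /fmin; rewrite ru eqxx.
move=> fu; have := none (f (col u)); rewrite mem_iota add0n fn fu Lf cf eqxx.
by move=> /(_ isT).
Qed.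

(** * Propagation along the line graph *)

Definition closed (s : state) : Prop :=
  forall v w, v < n -> w < n -> known s w -> link v w -> known s v.

(** Agreement with [x] up to exchanging the two ends of each known vertex independently. *)
Definition matches (x : nat -> nat -> bool) (s : state) : Prop :=
  forall v, v < n -> known s v -> exists b, forall u, u < n -> link v u ->
    bitn s 9 v u = x v u (+) b.

(** Properties of propagation that compose. The second says that a closed set does not grow, so that
    closedness reached early persists. *)
Definition extends (s s' : state) : Prop :=
  [/\ forall v, v < n -> known s v -> known s' v,
      closed s -> forall v, v < n -> known s' v -> known s v &
      forall x, consistent x -> matches x s -> matches x s'].

Lemma extends_refl s : extends s s. Proof. by split. Qed.

Lemma extends_trans s1 s2 s3 : extends s1 s2 -> extends s2 s3 -> extends s1 s3.
Proof.
move=> [a1 b1 c1] [a2 b2 c2]; split.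
- by move=> v vn /a1 h; apply: a2 => //; apply: h.
- move=> cl v vn h; apply: (b1 cl) => //; apply: b2 => //.
  move=> u w un wn hw uw; apply: a1 => //; apply: (cl u w) => //; exact: b1.
- by move=> x hx /c1 h; apply: c2 => //; apply: h.
Qed.

Lemma visit_spec s v w : colored s -> reg s 7 = v -> reg s 8 = w -> v < n -> w < n ->
  extends s (run P_visit s) /\ (known s w -> link v w -> known (run P_visit s) v).
Proof.
move=> hs r7 r8 vn wn; rewrite /P_visit run_if test_and test_not test_and test_link /= ?r7 ?r8 //.
have -> : test s (Read 8 (Reg 7)) = known s v by rewrite /test /= r7.
have -> : test s (Read 8 (Reg 8)) = known s w by rewrite /test /= r8.
case: ifP => [/and3P[Kv Kw Lvw]|E]; last first.
  split; first exact: extends_refl.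
  by move=> Kw Lvw; move: E; rewrite Kw Lvw; case: (known s v).
rewrite !run_seq run_wr /= r7.
set s1 := set_arr s _ _ _; set p := PFor _ _ _.
have c1 : colored s1 by apply: (@colored_run (PWr 8 (Reg 7) (Lit 1))).
(* Row [w] is read while row [v] is being written, so the two must differ. *)
have wv : (w == v) = false by apply: contraTF Kw => /eqP->.
have K1 u : known s1 u = known s u || (u == v).
  by rewrite /known /=; case: (u == v); rewrite ?orbT ?orbF.
pose I i s' := [/\ colored s', reg s' 7 = v, reg s' 8 = w,
  forall y u, u < n -> y != v -> bitn s' 9 y u = bitn s 9 y u &
  forall u, u < i -> bitn s' 9 v u = ~~ ((u == w) || (link w u && (bitn s 9 w u == bitn s 9 w v)))].
have [_ _ _ b1 b2] : I n (run p s1).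
  apply: run_for => //; first exact: colored0.
  move=> i s' hi ri [cs' r7' r8' h1 h2].
  set e := eNot _.
  have E : eval s' e = ~~ ((i == w) || (link w i && (bitn s 9 w i == bitn s 9 w v))) :> nat.
    rewrite eval_not test_or test_eq test_and test_link ?test_eq ?eval_bool /= ?ri ?r8' //.
    rewrite !(test_at _ _ _ (colored0 cs')) /= ri r7' r8' !h1 ?wv //.
    by congr (nat_of_bool (~~ (_ || (_ && _)))); case: (bitn s 9 w i); case: (bitn s 9 w v).
  have F y u : u < n -> bitn (run (PWr 9 (Bin Add (Bin Mul (Reg 7) (Reg 0)) (Reg 9)) e) s') 9 y u =
     if (y == v) && (u == i) then ~~ ((i == w) || (link w i && (bitn s 9 w i == bitn s 9 w v)))
     else bitn s' 9 y u.
    move=> un; rewrite /bit run_wr E /= r7' ri (colored0 cs') eqn_idx //.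
    by case: ifP => // _; case: (_ || _).
  split=> //.
  - by move=> y u un yv; rewrite -[LHS]/(bitn (run _ s') 9 y u) F // (negbTE yv) h1.
  - move=> u ui; rewrite -[LHS]/(bitn (run _ s') 9 v u) F ?eqxx /=; last by lia.
    by case: (eqVneq u i) => [-> //|ne]; apply: h2; lia.
have K2 u : known (run p s1) u = known s u || (u == v) by rewrite known_run // K1.
split; last by rewrite K2 eqxx orbT.
split.
- by move=> u un h; rewrite K2 h.
- move=> cl u un; rewrite K2 => /orP[] // /eqP->; exact: cl Lvw.
- move=> x hx hm u un; rewrite K2; case: (eqVneq u v) => [-> _|uv]; last first.
    rewrite orbF => /(hm u un)[b hb]; exists b => y yn Luy.
    by rewrite b1 // hb.
  have [b hb] := hm w wn Kw.
  (* The end shared with [w] has received value 0, so the ends of [v] are exchanged exactly when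
     [x v w] is true. *)
  exists (x v w) => y yn Lvy; rewrite b2 //.
  have Lwv : link w v by rewrite link_sym.
  case: (eqVneq y w) => [->|yw] /=; first by rewrite addbb.
  case: (boolP (link w y)) => Lwy /=; last first.
    have := hx v vn y w yn wn yw Lvy Lvw; rewrite link_sym // (negbTE Lwy) /=.
    by case: (x v y); case: (x v w).
  rewrite !hb //.
  have := hx v vn w y wn yn; rewrite eq_sym yw Lvw Lvy Lwy /= => /(_ isT isT isT).
  by case: (x v y); case: (x v w); case: (x w y); case: (x w v); case: (b).
Qed.

Lemma round_spec s : colored s -> let s' := run P_round s in
  extends s s' /\ (forall v w, v < n -> w < n -> known s w -> link v w -> known s' v).
Proof.
move=> hs.
pose I i s' := [/\ colored s', extends s s' &
  forall v w, v < i -> w < n -> known s w -> link v w -> known s' v].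
suff [_ h1 h2] : I n (run P_round s) by split.
apply: run_for => //; first exact: colored0.
move=> i s1 hi r7 [c1 e1 h1].
pose J j s' := [/\ colored s', reg s' 7 = i, extends s1 s' &
  forall w, w < j -> known s1 w -> link i w -> known s' i].
have [c2 _ e2 h2] : J n (run (PFor 8 0 P_visit) s1).
  apply: run_for => //; first exact: colored0.
  move=> j s2 hj r8 [c2 r7' e2 h2].
  have [e3 h3] := visit_spec c2 r7' r8 hi hj.
  split.
  - by apply: colored_set_reg => //; apply: colored_run.
  - by rewrite /= reg_run.
  - exact: extends_trans e2 e3.
  - move=> w; rewrite ltnS leq_eqVlt => /orP[/eqP->|wj] Kw Lw.
      by apply: h3 => //; case: e2 => m _ _; apply: m.
    by case: e3 => m _ _; apply: m => //; apply: h2 Lw.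
split.
- exact: colored_set_reg.
- exact: extends_trans e1 e2.
- move=> v w; rewrite ltnS leq_eqVlt => /orP[/eqP->|vi] wn Kw Lvw.
    by apply: h2 Lvw => //; case: e1 => m _ _; apply: m.
  by case: e2 => m _ _; apply: m; [lia | apply: h1 Lvw].
Qed.

(** A round on a set that is not closed adds a vertex. Starting from the root, more than [i]
    vertices are known after [i] rounds unless the set is closed, and more than [n] is
    impossible. *)
Lemma prop_spec s r : colored s -> r < n -> known s r -> let s' := run P_prop s in
  [/\ closed s', known s' r & forall x, consistent x -> matches x s -> matches x s'].
Proof.
move=> hs rn Kr.
pose Ks s' := [set v : 'I_n | known s' v].
pose I i s' := [/\ colored s', extends s s' & closed s' \/ i < #|Ks s'|].
suff [_ [m _ hm] h] : I n (run P_prop s).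
  split=> //; last exact: m.
  by case: h => // /leq_trans/(_ (max_card _)); rewrite card_ord ltnn.
apply: run_for => //; first exact: colored0.
  split=> //; right; apply/card_gt0P; exists (Ordinal rn).
  by rewrite inE.
move=> i s1 hi r6 [c1 e1 h1].
have [e2 h2] := round_spec c1; have [m2 n2 _] := e2.
split; first by apply: colored_set_reg => //; apply: colored_run.
  exact: extends_trans e1 e2.
set s2 := run P_round s1 in e2 h2 m2 n2 *.
have [cl|ncl] := boolP [forall v : 'I_n, forall w : 'I_n, known s1 w ==> link v w ==> known s1 v].
  have {}cl : closed s1.
    move=> v w vn wn; move/forallP/(_ (Ordinal vn))/forallP/(_ (Ordinal wn)): cl.
    by move=> /implyP h /h /implyP.
  left=> v w vn wn Kw Lvw; apply: m2 => //; apply: (cl v w) => //; exact: n2.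
right; case: h1 => [cl|h1].
  case/negP: ncl; apply/'forall_forallP => v w; apply/implyP => Kw; apply/implyP.
  exact: cl.
apply: leq_ltn_trans h1 _; apply: proper_card; apply/properP; split.
  by apply/subsetP => v; rewrite !inE; apply: m2.
move: ncl; rewrite negb_forall => /existsP[v]; rewrite negb_forall => /existsP[w].
rewrite negb_imply => /andP[Kw]; rewrite negb_imply => /andP[Lvw Kv].
by exists v; rewrite !inE //; apply: (h2 v w).
Qed.

Lemma check_spec s : colored s ->
  reg (run P_check s) 5 != 0 <-> (forall v, v < n -> known s v -> consistent_at (bitn s 9) v).
Proof.
move=> hs; rewrite /P_check run_seq.
set s1 := run (PAsg _ _) s.
have [c1 f1] : colored s1 /\ reg s1 5 = 1 by split=> //; apply: colored_run.
have E v u w : v < n -> u < n -> w < n ->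
    test (set_reg (set_reg (set_reg s1 6 v) 7 u) 8 w) bad_test =
    [&& known s v, u != w, link v u, link v w & (bitn s 9 v u == bitn s 9 v w) !=
        link u w && (bitn s 9 u v == bitn s 9 u w)].
  move=> vn un wn; set s2 := set_reg _ _ _; rewrite /bad_test.
  have c2 : colored s2 by [].
  rewrite test_and test_and test_not test_eq test_and test_link // test_and test_link //=.
  congr [&& _, _, _, _ & _].
  rewrite test_eq eval_eq eval_not test_and test_link //.
  rewrite test_eq !eval_bool !(test_at _ _ _ (colored0 c2)) /=.
  rewrite -[bit n s2 9]/(bitn s 9).
  by case: (bitn s 9 v u); case: (bitn s 9 v w); case: (link u w);
    case: (bitn s 9 u v); case: (bitn s 9 u w).
clearbody s1; rewrite reg_scan // f1; case: ifP => H; split=> // h.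
  case/hasP: H => v; rewrite /= (colored0 c1) mem_iota add0n => /= vn /hasP[u].
  rewrite mem_iota add0n => /= un /hasP[w]; rewrite mem_iota add0n => /= wn.
  by rewrite E // => /and5P[Kv uw Lu Lw]; rewrite (h v vn Kv) // eqxx.
move=> v vn Kv u w un wn uw Lu Lw.
have [//|ne] := eqVneq (bitn s 9 v u == bitn s 9 v w) (link u w && (bitn s 9 u v == bitn s 9 u w)).
move/negP: H; case.
rewrite /= (colored0 c1); apply/hasP; exists v; rewrite ?mem_iota //.
apply/hasP; exists u; rewrite ?mem_iota //.
by apply/hasP; exists w; rewrite ?mem_iota // E // Kv uw Lu Lw.
Qed.

(** * Collecting the solved components *)

Definition solved (s : state) v : bool := arr s 10 v != 0.

Lemma copy_spec s : colored s -> let s' := run P_copy s in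
  if reg s 5 != 0 then
    (forall v, v < n -> solved s' v = solved s v || known s v) /\
    (forall v u, v < n -> u < n ->
      bitn s' 11 v u = if known s v then bitn s 9 v u else bitn s 11 v u)
  else s' = s.
Proof.
move=> hs; rewrite /P_copy run_if /test /=; case: (reg s 5 != 0) => //.
set p := PFor _ _ _.
pose I i s' := [/\ colored s', (forall j, arr s' 8 j = arr s 8 j) /\ (forall j, arr s' 9 j = arr s 9 j),
  forall v, v < n -> solved s' v = solved s v || (v < i) && known s v &
  forall v u, v < n -> u < n ->
      bitn s' 11 v u = if (v < i) && known s v then bitn s 9 v u else bitn s 11 v u].
suff [_ _ h1 h2] : I n (run p s).
  by split=> [v vn|v u vn un]; [rewrite h1 // vn | rewrite h2 // vn].
apply: run_for => //; first exact: colored0.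
  by split=> // v; rewrite orbF.
move=> i s1 hi r6 [c1 [k1 x1] h1 h2]; rewrite run_if.
have -> : test s1 (Read 8 (Reg 6)) = known s i by rewrite /test /= r6 k1.
have step v : (v < i.+1) && known s v = (v < i) && known s v || (v == i) && known s i.
  rewrite ltnS leq_eqVlt; case: (eqVneq v i) => [->|] //=; last by rewrite orbF.
  by rewrite ltnn.
case: ifP => Ki; last first.
  split=> //= v; first by move=> vn; rewrite step Ki andbF orbF -h1.
  by move=> u vn un; rewrite step Ki andbF orbF -h2.
rewrite run_seq run_wr /= r6; set s2 := set_arr _ _ _ _.
pose J j s' := [/\ colored s', reg s' 6 = i, forall j, arr s' 9 j = arr s 9 j &
  forall v u, v < n -> u < n ->
      bitn s' 11 v u = if (v < i) && known s v || (v == i) && (u < j) then bitn s 9 v u else bitn s 11 v u].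
set q := PFor _ _ _.
have [c3 _ x3 h3] : J n (run q s2).
  apply: run_for => //; first exact: (colored0 c1).
    by split=> // v u vn un; rewrite andbF orbF -h2.
  move=> j s3 hj r7 [c3 r6' x3 h3].
  split; [exact: colored_set_reg | by [] | by [] |].
  move=> v u vn un; rewrite /bit run_wr /= r6' r7 (colored0 c3) x3 eqn_idx //.
  rewrite [u < j.+1]ltnS [u <= j]leq_eqVlt; case: (eqVneq v i) => [->|vi] /=; last first.
    by have := h3 v u vn un; rewrite (negbTE vi).
  rewrite ltnn /=; case: (eqVneq u j) => [->|uj] //=.
  by have := h3 i u hi un; rewrite ltnn eqxx.
split.
- exact: colored_set_reg.
- by split=> j //=; rewrite arr_run //= k1.
- move=> v vn; rewrite /solved /= arr_run //= step Ki andbT.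
  by case: (eqVneq v i) => [->|vi]; rewrite ?orbT // orbF; apply: h1.
- by move=> v u vn un; rewrite -[LHS]/(bitn (run q s2) 11 v u) h3 // step Ki un !andbT.
Qed.

Definition good (s : state) : Prop :=
  (forall v w, v < n -> w < n -> solved s w -> link v w -> solved s v) /\
  (forall v, v < n -> solved s v -> consistent_at (bitn s 11) v).

(** Consistency at a vertex involves its own row and those of its neighbors. The reached set is
    closed, so these rows are all replaced or all kept. Correct values at the root propagate to [x]
    up to exchanges of ends, which consistency does not see, so the check succeeds. *)
Lemma mask_spec cs s r : colored s -> reg s 10 = r -> r < n -> good s ->
  let s' := run (P_mask cs) s in
  [/\ good s', forall v, v < n -> solved s v -> solved s' v &
      forall x, consistent x -> (forall u, u < n -> link r u -> mask_split cs r u = x r u) -> solved s' r].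
Proof.
move=> hs hr rn [g1 g2]; rewrite /P_mask !run_seqsE.
have [K1 X1] := start_spec cs hs hr rn.
set s1 := run (P_start cs) s in K1 X1 *.
have c1 : colored s1 by apply: colored_run.
have [cl2 Kr M2] := prop_spec c1 rn (etrans (K1 r rn) (eqxx r)).
set s2 := run P_prop s1 in cl2 Kr M2 *.
have c2 : colored s2 by apply: colored_run.
have ch := check_spec c2; set s3 := run P_check s2 in ch *.
have c3 : colored s3 by apply: colored_run.
have D3 v : solved s3 v = solved s v by rewrite /solved !arr_run.
have S3 v u : bitn s3 11 v u = bitn s 11 v u by rewrite !bit_run.
have K3 v : known s3 v = known s2 v by rewrite known_run.
have B3 v u : bitn s3 9 v u = bitn s2 9 v u by rewrite bit_run.
have := copy_spec c3; set s4 := run P_copy s3; move=> /=.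
clearbody s4 s3 s2 s1; case: ifP => [ok|nok].
  move=> [D4 S4]; have {}ch := ch.1 ok; split.
  - split=> [v w vn wn|v vn].
      rewrite !D4 // !D3 !K3 => /orP[Dw|Kw] Lvw; first by rewrite (g1 v w).
      by rewrite (cl2 v w) ?orbT.
    rewrite D4 // D3 K3 => h u w un wn uw Lvu Lvw.
    rewrite !S4 // !K3 !B3 !S3.
    have KL y : y < n -> link v y -> known s2 y = known s2 v.
      move=> yn Lvy; apply/idP/idP => Ky; first exact: (cl2 v y).
      by apply: (cl2 y v) => //; rewrite link_sym.
    rewrite (KL u) //; case: ifP h => [Kv _|Kv]; first exact: ch.
    by rewrite orbF => Dv; apply: g2.
  - by move=> v vn Dv; rewrite D4 // D3 Dv.
  - by move=> x _ _; rewrite D4 // K3 Kr orbT.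
move=> ->; split.
- split=> [v w vn wn|v vn]; first by rewrite !D3; apply: g1.
  by rewrite D3 => Dv u w un wn uw Lu Lw; rewrite !S3; apply: g2.
- by move=> v vn; rewrite D3.
- move=> x hx hsp; move/negbT/negP: nok => [].
  apply/ch => v vn Kv u w un wn uw Lu Lw.
  have m : matches x s2.
    apply: M2 => // y yn; rewrite K1 // => /eqP->; exists false => z zn Lz.
    by rewrite addbF X1 // hsp.
  have Ku : known s2 u by apply: (cl2 u v) => //; rewrite link_sym.
  have [b hb] := m v vn Kv; have [b' hb'] := m u un Ku.
  have Luv : link u v by rewrite link_sym.
  (* The exchanges [b] and [b'] cancel, since each equality compares two values at one vertex. *)
  rewrite !hb // hb' //.
  have := hx v vn u w un wn uw Lu Lw; case: (boolP (link u w)) => Luw /=.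
    rewrite hb' //.
    by case: (x v u); case: (x v w); case: (x u v); case: (x u w); case: (b); case: (b').
  by case: (x v u); case: (x v w); case: (b).
Qed.

Lemma nwr_mask r cs : r \in [:: 0; 3; 10] -> nwr r (P_mask cs).
Proof. by rewrite !inE => /or3P[] /eqP->. Qed.

Lemma nwa_mask a cs : a \in [:: 5; 6] -> nwa a (P_mask cs).
Proof. by rewrite !inE => /orP[] /eqP->. Qed.

Lemma colored_mask cs s : colored s -> colored (run (P_mask cs) s).
Proof. by apply: colored_run; rewrite ?nwr_mask ?nwa_mask. Qed.

Lemma masks_spec css s r : colored s -> reg s 10 = r -> r < n -> good s ->
  let s' := run (seqs [seq P_mask cs | cs <- css]) s in
  [/\ colored s', reg s' 10 = r, good s', forall v, v < n -> solved s v -> solved s' v &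
      forall x cs, cs \in css -> consistent x ->
        (forall u, u < n -> link r u -> mask_split cs r u = x r u) -> solved s' r].
Proof.
elim: css s => [|cs css IH] s hs hr rn g /=; first by split.
rewrite run_seq.
have [g1 m1 h1] := mask_spec cs hs hr rn g.
have c1 := colored_mask cs hs.
have r1 : reg (run (P_mask cs) s) 10 = r by rewrite reg_run // nwr_mask.
have [c2 r2 g2 m2 h2] := IH _ c1 r1 rn g1; split=> //.
  by move=> v vn Dv; apply: m2 => //; apply: m1.
move=> x cs'; rewrite inE => /orP[/eqP->|h] hx hs'; last exact: h2 hs'.
by apply: m2 => //; apply: h1 hs'.
Qed.

(** For each root some subset on the list describes [x] there; other subsets do no harm, because
    solved vertices stay solved. *)
Lemma lines_spec s : colored s -> let s' := run (P_lines k) s in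
  [/\ colored s', good s' &
      (forall v, v < n -> col v < k) -> (exists x, consistent x) -> forall v, v < n -> solved s' v].
Proof.
move=> hs; rewrite /P_lines run_seq.
set s1 := run (PFor 6 0 _) s.
have c1 : colored s1 by apply: colored_run.
have D1 v : v < n -> solved s1 v = false.
  move=> vn; pose I i s' := forall v, v < i -> solved s' v = false.
  suff H : I n s1 by apply: H.
  apply: run_for => //; first exact: colored0.
  move=> i s' hi ri h u; rewrite ltnS leq_eqVlt /solved !runE /= ri.
  by case: eqVneq => //= _; apply: h.
clearbody s1.
pose I i s' := [/\ colored s', good s' & 
  (forall v, v < n -> col v < k) -> (exists x, consistent x) -> forall v, v < i -> solved s' v].
apply: (@run_for I) => //; first exact: colored0.
- by rewrite nwr_seqs all_map; apply/allP => cs _; apply: nwr_mask.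
- split=> //; split=> [v w vn wn|v vn]; first by rewrite /solved /= -/(solved s1 w) D1.
  by rewrite /solved /= -/(solved s1 v) D1.
move=> i s2 hi r2 [c2 g2 h2].
have [c3 r3 g3 m3 h3] := masks_spec (subs (iota 0 k)) c2 r2 hi g2.
split; [exact: colored_set_reg | exact: g3 |].
move=> colk [x hx] v; rewrite ltnS leq_eqVlt => /orP[/eqP->|vi].
  have [cs hcs hsp] := split_complete hi colk hx.
  exact: (h3 x cs).
by apply: m3; [lia | apply: h2 => //; exists x].
Qed.
End Lines.

(** * Certificates and the output *)

Section Certificate.
Variables (n k : nat) (A : nat -> nat -> bool).

(** The certificate of a proper color-line graph: a partition into [k] cliques together with the
    ends at which linked vertices meet. *)
Definition cert (col : nat -> nat) (x : nat -> nat -> bool) : Prop :=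
  [/\ forall v, v < n -> col v < k,
      forall u v, u < n -> v < n -> u != v -> col u = col v -> A u v &
      consistent n A col x].

(** Three equally colored neighbors of a vertex of another color are pairwise not linked, so
    consistency would give them three distinct Boolean values; this is the hypothesis [q_three]. *)
Lemma cert_coloring col x : 0 < k -> cert col x ->
  exists2 g, g \in strings k (3 * k) &
    forall v, v < n -> foldl (color_next n k A) (fun=> k) g v = col v.
Proof.
move=> k0 [h1 h2 h3]; apply: coloring_complete => //.
move=> v y z w vn yn zn wn yz zw Avy Avz Avw czy cwy; apply/eqP/idPn => ne.
have Lv u : A v u -> col u = col y -> link A col v u by rewrite /link => -> -> /=.
have nL u u' : col u = col y -> col u' = col y -> link A col u u' = false.
  by rewrite /link => -> ->; rewrite eqxx andbF.
have key u u' : u < n -> u' < n -> u < u' -> A v u -> A v u' ->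
    col u = col y -> col u' = col y -> (x v u == x v u') = false.
  move=> un un' uu' a a' cu cu'; have ne' : u != u' by lia.
  by rewrite (h3 v vn u u' un un' ne' (Lv u a cu) (Lv u' a' cu')) nL.
have := key y z yn zn yz Avy Avz erefl czy.
have := key z w zn wn zw Avz Avw czy cwy.
have := key y w yn wn (ltn_trans yz zw) Avy Avw erefl cwy.
by case: (x v y); case: (x v z); case: (x v w).
Qed.
End Certificate.

Section Output.
Variables (n k : nat) (A : nat -> nat -> bool) (col : nat -> nat).

Definition same_end (x : nat -> nat -> bool) (v t f : nat) : bool :=
  (2 * v + t == f) || (link A col v (f %/ 2) &&
     ((nat_of_bool (x v (f %/ 2)) == t) && (2 * (f %/ 2) + x (f %/ 2) v == f))).

(** The largest flag of a class serves as its representative. For [v < n] and [t < 2] the flag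
    [2 * v + t] itself qualifies, so the default is not reached. *)
Definition end_id x v t : nat := last_index (same_end x v t) (n + n) 0.

Lemma test_rel s v f t : colored n A col s -> reg s 6 = v -> reg s 7 = f ->
  v < n -> f < n + n -> test s (rel_test t) = same_end (bit n s 11) v t f.
Proof.
move=> hs r6 r7 vn fn; have f2 : f %/ 2 < n by lia.
rewrite /rel_test test_or test_eq test_and (test_link hs) /= ?r6 ?r7 //.
by rewrite test_and !test_eq /= r6 r7 !eqb0 (colored0 hs).
Qed.

Lemma out_spec s : colored n A col s -> let s' := run P_out s in
  [/\ reg s' 2 = 1, reg s' 4 = n,
      forall v, v < n -> arr s' 2 v = end_id (bit n s 11) v 0,
      forall v, v < n -> arr s' 3 v = end_id (bit n s 11) v 1 &
      forall v, v < n -> arr s' 4 v = col v].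
Proof.
move=> hs; rewrite /P_out !run_seqsE; set p := PFor _ _ _.
pose I i s' := [/\ colored n A col s', forall j, arr s' 11 j = arr s 11 j &
  [/\ forall v, v < i -> arr s' 2 v = end_id (bit n s 11) v 0,
      forall v, v < i -> arr s' 3 v = end_id (bit n s 11) v 1 &
      forall v, v < i -> arr s' 4 v = col v]].
suff [c1 _ [h2 h3 h4]] : I n (run p s).
  by split=> //; rewrite !run_asg /=; apply: colored0 c1.
apply: run_for => //; first exact: (colored0 hs).
move=> i s1 hi r6 [c1 x1 [h2 h3 h4]]; rewrite !run_seqsE.
set s2 := run (PWr 3 _ _) _; set q := PFor _ _ _.
have a2 a j : arr s2 a j = if (a == 4) && (j == i) then col i else
    if ((a == 2) || (a == 3)) && (j == i) then 0 else arr s1 a j.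
  rewrite /s2 !run_wr /= r6 c1.2 //.
  case: (a =P 4) => [->|_] /=; first by case: (j == i).
  case: (a =P 3) => [->|_] /=; first by case: (j == i).
  by case: (a =P 2) => [->|_] /=; case: (j == i).
have [c2 r62] : colored n A col s2 /\ reg s2 6 = i.
  by split=> //; do 3!apply: colored_run => //.
clearbody s2.
pose J j s' := [/\ colored n A col s', reg s' 6 = i,
  [/\ forall a, arr s' 11 a = arr s 11 a, forall a, arr s' 4 a = arr s2 4 a,
    forall a, a != i -> arr s' 2 a = arr s1 2 a & forall a, a != i -> arr s' 3 a = arr s1 3 a],
  arr s' 2 i = last_index (same_end (bit n s 11) i 0) j 0 &
  arr s' 3 i = last_index (same_end (bit n s 11) i 1) j 0].
have [c3 _ [x3 x4 y2 y3] z2 z3] : J (n + n) (run q s2).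
  apply: run_for => //; first by case: c2 => -[].
    split=> //=; [split=> a /= | by rewrite a2 eqxx | by rewrite a2 eqxx].
    - by rewrite a2 x1.
    - by [].
    - by move=> /negbTE ai; rewrite a2 ai.
    - by move=> /negbTE ai; rewrite a2 ai.
  move=> j s3 hj r7 [c3 r63 [w1 w4 w2 w3] l2 l3].
  rewrite run_seq.
  have T s4 t : colored n A col s4 -> reg s4 6 = i -> reg s4 7 = j ->
      (forall a, arr s4 11 a = arr s 11 a) ->
      test s4 (rel_test t) = same_end (bit n s 11) i t j.
    move=> c4 r64 r74 a4; rewrite (test_rel t c4 r64 r74) //.
    by rewrite /same_end /bit !a4.
  rewrite [run (PIf (rel_test 0) _ _) s3]run_if (T s3) //.
  set s4 := if _ then _ else _.
  have [c4 r64 r74] : [/\ colored n A col s4, reg s4 6 = i & reg s4 7 = j].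
    by rewrite /s4; case: ifP => _; split=> //; apply: colored_run.
  have a4 a b : arr s4 a b = if same_end (bit n s 11) i 0 j && ((a == 2) && (b == i)) then j else arr s3 a b.
    by rewrite /s4; case: (same_end _ _ _ _) => //; rewrite run_wr /= r63 r7.
  clearbody s4; rewrite run_if (T s4) //; last by move=> a; rewrite a4 andbF.
  set s5 := if _ then _ else _.
  have [c5 r65] : colored n A col s5 /\ reg s5 6 = i.
    by rewrite /s5; case: ifP => _; split=> //; apply: colored_run.
  have a5 a b : arr s5 a b = if same_end (bit n s 11) i 1 j && ((a == 3) && (b == i)) then j else arr s4 a b.
    by rewrite /s5; case: (same_end _ _ _ _) => //; rewrite run_wr /= r64 r74.
  clearbody s5; split=> //=.
  - split=> a; rewrite ?a5 ?a4 /= ?andbF //.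
    + by move=> ai; rewrite (negbTE ai) !andbF; apply: w2.
    + by move=> ai; rewrite (negbTE ai) !andbF; apply: w3.
  - by rewrite a5 a4 /= eqxx !andbT andbF /= l2.
  - by rewrite a5 a4 /= eqxx !andbT andbF /= l3.
split; [exact: colored_set_reg | by [] | split=> v; rewrite ltnS leq_eqVlt /=].
- by case: (eqVneq v i) => [->|vi] //= vi'; rewrite y2 // h2.
- by case: (eqVneq v i) => [->|vi] //= vi'; rewrite y3 // h3.
- by rewrite x4 a2 /=; case: (eqVneq v i) => [->|vi] //= vi'; apply: h4.
Qed.

Lemma final_spec s : colored n A col s -> good n A col s -> reg s 2 = 0 ->
  let s' := run (P_final k) s in
  (reg s' 2 != 0 ->
     [/\ cert n k A col (bit n s 11), reg s' 4 = n,
      forall v, v < n -> arr s' 2 v = end_id (bit n s 11) v 0,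
      forall v, v < n -> arr s' 3 v = end_id (bit n s 11) v 1 &
      forall v, v < n -> arr s' 4 v = col v]) /\
  ((forall v, v < n -> solved s v) -> (exists x, cert n k A col x) -> reg s' 2 != 0).
Proof.
move=> hs [_ hg] r2; rewrite /P_final !run_seqsE.
set s1 := run (PAsg _ _) s.
have [c1 f1 r21] : [/\ colored n A col s1, reg s1 5 = 1 & reg s1 2 = 0].
  by split=> //; apply: colored_run.
have a1 a j : arr s1 a j = arr s a j by [].
clearbody s1.
set e1 := eNot (eAnd (Read 10 _) _); set s2 := run (scan [:: 6] _ _ _) s1.
have H1 : holds [:: 6] e1 s1 = has (fun v => ~~ (solved s v && (col v < k))) (iota 0 n).
  rewrite /= (colored0 c1); apply: eq_in_has => v; rewrite mem_iota add0n /= => vn.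
  by rewrite /e1 test_not test_and test_lt /test /= c1.2 // a1.
have [c2 r22] : colored n A col s2 /\ reg s2 2 = 0.
  by split; [apply: colored_run | rewrite reg_run].
have f2 : reg s2 5 = if has (fun v => ~~ (solved s v && (col v < k))) (iota 0 n) then 0 else 1.
  by rewrite reg_scan // H1 f1.
have a2 a j : arr s2 a j = arr s a j by rewrite arr_run ?nwa_scan.
clearbody s2 => {H1}.
set e2 := eAnd _ _; set s3 := run (scan [:: 6; 7] _ _ _) s2.
have H2 : holds [:: 6; 7] e2 s2 = has (fun u => has (fun v =>
    (u != v) && ((col u == col v) && ~~ A u v)) (iota 0 n)) (iota 0 n).
  rewrite /= (colored0 c2); apply: eq_in_has => u; rewrite mem_iota add0n /= => un.
  apply: eq_in_has => v; rewrite mem_iota add0n /= => vn.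
  rewrite /e2 test_and test_not test_eq test_and test_eq test_not.
  have e0 : reg (set_reg (set_reg s2 6 u) 7 v) 0 = n := colored0 c2.
  rewrite (test_at _ _ _ e0) /= !c2.2 //.
  by case: c2 => -[_ _ h] _; rewrite -h.
have f3 : reg s3 5 = if has (fun u => has (fun v =>
    (u != v) && ((col u == col v) && ~~ A u v)) (iota 0 n)) (iota 0 n) then 0 else
    if has (fun v => ~~ (solved s v && (col v < k))) (iota 0 n) then 0 else 1.
  by rewrite reg_scan // H2 f2.
have [c3 r23] : colored n A col s3 /\ reg s3 2 = 0.
  by split; [apply: colored_run | rewrite reg_run].
have a3 a j : arr s3 a j = arr s a j by rewrite arr_run ?nwa_scan.
clearbody s3 => {H2}.
have [o2 o4 oa ob oc] := out_spec c3.
rewrite run_if; case Et: (test s3 (Reg 5)); move: Et; rewrite /test [eval _ _]/= f3; last first.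
  move=> Et; split; first by rewrite run_skip r23.
  move=> hD [x [h1 h2 _]]; move: Et.
  case: (boolP (has _ _)) => [/hasP[u]|_].
    rewrite mem_iota add0n /= => un /hasP[v]; rewrite mem_iota add0n /= => vn.
    by case/and3P=> uv /eqP cuv; rewrite h2.
  case: (boolP (has _ _)) => [/hasP[v]|//].
  by rewrite mem_iota add0n /= => vn; rewrite hD // h1.
case: (boolP (has _ _)) => [//|/hasPn n1].
case: (boolP (has _ _)) => [//|/hasPn n2] _.
split; last by rewrite o2.
move=> _.
have E v t : end_id (bit n s3 11) v t = end_id (bit n s 11) v t.
  by apply: eq_last_index => i _; rewrite /same_end /bit !a3.
have h v : v < n -> solved s v && (col v < k).
  by move=> vn; move: (n2 v); rewrite mem_iota vn negbK => /(_ isT).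
split=> //.
- split; first by move=> v /h /andP[].
    move=> u v un vn uv cuv; move: (n1 u); rewrite mem_iota un => /(_ isT)/hasPn/(_ v).
    by rewrite mem_iota vn uv cuv eqxx /= negbK => /(_ isT).
  by move=> v vn; apply: hg => //; case/andP: (h v vn).
- by move=> v vn; rewrite oa // E.
- by move=> v vn; rewrite ob // E.
Qed.
End Output.

(** * Graphs *)

Lemma eq_set2 (T : finType) (a b c d : T) :
  [set a; b] = [set c; d] -> (a = c /\ b = d) \/ (a = d /\ b = c).
Proof.
move=> E.
have /set2P ha : a \in [set c; d] by rewrite -E set21.
have /set2P hb : b \in [set c; d] by rewrite -E set22.
have /set2P hc : c \in [set a; b] by rewrite E set21.
have /set2P hd : d \in [set a; b] by rewrite E set22.
by intuition congruence.
Qed.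

Lemma mem_edge_set (G : sgraph) (x y : G) : ([set x; y] \in edge_set G) = adj x y.
Proof.
apply/imset2P/idP => [[a b _]|h]; last by exists x y; rewrite ?inE.
by rewrite !inE => h /eq_set2[] [-> ->] //; rewrite adj_sym.
Qed.

Section Graph.
Variable G : sgraph.
Implicit Types x y : G.

Local Notation n := #|G|.

Definition rank (x : G) : nat := enum_rank x.

Lemma rank_lt x : rank x < n. Proof. exact: ltn_ord. Qed.

Lemma rank_inj : injective rank.
Proof. by move=> x y /val_inj/enum_rank_inj. Qed.

Lemma rankP i : i < n -> exists x, i = rank x.
Proof. by move=> hi; exists (enum_val (Ordinal hi)); rewrite /rank enum_valK. Qed.

Definition rank_adj (i j : nat) : bool :=
  [exists x, exists y, [&& rank x == i, rank y == j & adj x y]].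

Lemma rank_adjE x y : rank_adj (rank x) (rank y) = adj x y.
Proof.
apply/existsP/idP => [[a /existsP[b /and3P[/eqP/rank_inj-> /eqP/rank_inj->]]]|h] //.
by exists x; apply/existsP; exists y; rewrite !eqxx.
Qed.

Lemma rank_adj_sym i j : i < n -> j < n -> rank_adj i j = rank_adj j i.
Proof. by move=> /rankP[x ->] /rankP[y ->]; rewrite !rank_adjE adj_sym. Qed.

Lemma adj_spec (es : seq (G * G)) s : edge_list es ->
  reg s 0 = n -> reg s 1 = size es -> reg s 3 = n + n ->
  (forall i, arr s 0 i = nth 0 (tails es) i) -> (forall i, arr s 1 i = nth 0 (heads es) i) ->
  (forall i, arr s 5 i = 0) -> input_ok n rank_adj (run P_adj s).
Proof.
move=> hes r0 r1 r3 a0 a1 a5; split; rewrite ?reg_run //.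
pose hit x y (p : G * G) := ((x == p.1) && (y == p.2)) || ((x == p.2) && (y == p.1)).
pose I i s' := [/\ reg s' 0 = n, forall j, arr s' 0 j = nth 0 (tails es) j,
  forall j, arr s' 1 j = nth 0 (heads es) j &
  forall x y, bit n s' 5 (rank x) (rank y) = has (hit x y) (take i es)].
have [_ _ _ H] : I (size es) (run P_adj s).
  apply: run_for => //; first by split=> // x y; rewrite take0 /bit /= a5.
  move=> i s1 hi r6 [e0 e1 e2 e5]; split=> // x y.
  case: es hi a0 a1 hes e1 e2 e5 I r1 => // p0 es'; set es := p0 :: es' => hi a0 a1 hes e1 e2 e5 _ _.
  rewrite (take_nth p0) // has_rcons -e5 /bit !runE /= r6 e0 e1 e2.
  rewrite !(nth_map p0) // !eqn_idx ?rank_lt // /hit.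
  rewrite -!/(rank _) !(inj_eq rank_inj).
  move: (nth p0 es i) => [a b] /=.
  by case: (x == a); case: (y == b); case: (x == b); case: (y == a).
move=> i j /rankP[x ->] /rankP[y ->]; rewrite H take_size rank_adjE -mem_edge_set.
rewrite -mem_enum -(perm_mem hes); apply/hasP/mapP => [[p pe h]|[p pe h]]; exists p => //.
  by case/orP: h => /andP[/eqP-> /eqP->] //; rewrite setUC.
by rewrite /hit; case: (eq_set2 h) => [] [-> ->]; rewrite !eqxx ?orbT.
Qed.

(** Each edge of [H] gets a distinguished end [bb], and the value at [g] for [g'] tells whether they
    meet there. If [u] and [w] meet [v] at one vertex, they meet each other there; conversely, if
    [u] meets [v] and [w] at the same vertex, this vertex is common to all three. *)
Lemma cert_of_graph k : proper_color_line_graph k G ->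
  exists col (sg : nat -> nat -> bool), cert n k rank_adj col sg.
Proof.
case=> H [phi [prop [f [fi fK Kf] fadj]]].
(* The empty graph is treated apart, because [vt] needs a default vertex. *)
have [x0 _|G0] := pickP (predT : pred G); last first.
  have n0 : n = 0 by apply: eq_card0.
  by exists (fun=> 0), (fun _ _ => false); split=> [v|u v|v]; rewrite n0.
have f_inj : injective f := can_inj fK.
have two g : exists a b, a != b /\ val (f g) = [set a; b].
  have /imset2P[a b _] := valP (f g); rewrite !inE => h E.
  by exists a, b; split=> //; apply: contraTneq h => ->; rewrite adj_irr.
have ex g : exists z, z \in val (f g).
  by have [a [b [_ ->]]] := two g; exists a; rewrite set21.
pose bb g := xchoose (ex g); have bbP g : bb g \in val (f g) := xchooseP (ex g).
pose X g g' := bb g \in val (f g').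
(* Distinct edges share at most one vertex: two common ends would make them the same pair. *)
have uniq_end g g' z z' : g != g' -> z \in val (f g) -> z \in val (f g') ->
    z' \in val (f g) -> z' \in val (f g') -> z = z'.
  move=> ne h1 h2 h3 h4; apply/eqP/idPn => zz.
  have S h : z \in val (f h) -> z' \in val (f h) -> [set z; z'] = val (f h).
    move=> zh zh'; apply/eqP; rewrite eqEcard subUset !sub1set zh zh' cards2 zz.
    by have [a [b [ab ->]]] := two h; rewrite cards2 ab.
  by case/negP: ne; apply/eqP/f_inj/val_inj; rewrite /= -S // -S.
have Xeq g g' z : g != g' -> z \in val (f g) -> z \in val (f g') -> X g g' = (bb g == z).
  move=> ne zg zg'; apply/idP/eqP => [h|E]; last by rewrite /X E.
  exact: (uniq_end g g').
have X2 g g1 g2 z1 z2 : g != g1 -> g != g2 -> z1 \in val (f g) -> z1 \in val (f g1) ->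
    z2 \in val (f g) -> z2 \in val (f g2) -> (X g g1 == X g g2) = (z1 == z2).
  move=> ne1 ne2 h1 h1' h2 h2'; rewrite (Xeq _ _ z1) // (Xeq _ _ z2) //.
  move: h1 h2 (bbP g); have [a [b [ab ->]]] := two g.
  have ba : (b == a) = false by rewrite eq_sym (negbTE ab).
  by rewrite !inE => /orP[]/eqP-> /orP[]/eqP-> /orP[]/eqP->;
    rewrite ?eqxx ?(negbTE ab) ?ba.
pose vt i := nth x0 (enum G) i.
have vtK g : vt (rank g) = g by rewrite /vt nth_enum_rank.
pose col i := nat_of_ord (phi (f (vt i))).
pose sg i j := X (vt i) (vt j).
(* Edges sharing an end have different colors by properness, so removing equally colored pairs
   leaves exactly the line graph. *)
have LE g g' : link rank_adj col (rank g) (rank g') =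
    (g != g') && share_end (f g) (f g').
  rewrite /link rank_adjE /col !vtK -fadj /= /cl_adj (inj_eq f_inj).
  case: (eqVneq g g') => //= ne; have := prop (f g) (f g').
  rewrite (inj_eq f_inj) ne (inj_eq val_inj) => /(_ isT).
  case: share_end => [->//|_] /=; by case: (phi _ == _).
have LP g g' : link rank_adj col (rank g) (rank g') ->
    g != g' /\ exists z, z \in val (f g) /\ z \in val (f g').
  rewrite LE => /andP[ne /set0Pn[z]]; rewrite inE => /andP[]; by split=> //; exists z.
exists col, sg; split.
- by move=> v _; apply: ltn_ord.
- move=> _ _ /rankP[g ->] /rankP[h ->]; rewrite (inj_eq rank_inj) rank_adjE -fadj /=.
  rewrite /cl_adj (inj_eq f_inj) /col !vtK => -> /= /val_inj->.
  by rewrite eqxx orbT.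
move=> _ /rankP[v ->] _ _ /rankP[u ->] /rankP[w ->]; rewrite (inj_eq rank_inj) => uw.
move=> /LP[vu [z1 [z1v z1u]]] /LP[vw [z2 [z2v z2w]]].
have uv : u != v by rewrite eq_sym.
rewrite /sg !vtK (X2 v u w z1 z2) //; apply/eqP/andP => [E|[/LP[_ [z3 [z3u z3w]]]]].
  rewrite -E in z2v z2w; split.
    by rewrite LE uw; apply/set0Pn; exists z1; rewrite inE z1u.
  by rewrite (X2 u v w z1 z1).
rewrite (X2 u v w z1 z3) // => /eqP E; rewrite -E in z3w.
by apply: (uniq_end v w).
Qed.

(** * The root graph built from a certificate *)

Section OutputGraph.
Variables (k : nat) (col : nat -> nat) (sg : nat -> nat -> bool).
Hypothesis hc : cert n k rank_adj col sg.

Local Notation linkG := (link rank_adj col).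

Definition flag_eq (v : nat) (t : bool) (u : nat) (t' : bool) : bool :=
  ((v == u) && (t == t')) || [&& linkG v u, sg v u == t & sg u v == t'].

Lemma rank_link_sym u v : u < n -> v < n -> linkG u v = linkG v u.
Proof. exact: link_sym rank_adj_sym u v. Qed.

Lemma flag_sym v t u t' : v < n -> u < n -> flag_eq v t u t' = flag_eq u t' v t.
Proof.
move=> vn un; rewrite /flag_eq rank_link_sym // [v == u]eq_sym [t == t']eq_sym.
by congr (_ || (_ && _)); rewrite andbC.
Qed.

(** Identification along a single link is already transitive. If [v] and [w] meet [u] at the same
    end, consistency at [u] links them and places [u] and the other one at the same end of each. *)
Lemma flag_trans v t u t' w t'' : v < n -> u < n -> w < n ->
  flag_eq v t u t' -> flag_eq u t' w t'' -> flag_eq v t w t''.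
Proof.
case: hc => _ _ hx vn un wn; case/orP=> [/andP[/eqP-> /eqP->] //|].
case/and3P=> Lvu /eqP xvu /eqP xuv; case/orP=> [/andP[/eqP<- /eqP<-]|].
  by rewrite /flag_eq Lvu xvu xuv !eqxx orbT.
case/and3P=> Luw /eqP xuw /eqP xwu; rewrite /flag_eq.
have Luv : linkG u v by rewrite rank_link_sym.
case: (eqVneq v w) => [E|vw] /=; first by rewrite -xvu -xwu E eqxx.
have := hx u un v w vn wn vw Luv Luw.
rewrite xuv xuw eqxx => /esym/andP[-> /eqP <-].
have := hx u un w v wn vn; rewrite eq_sym vw => /(_ isT Luw Luv).
by rewrite xuv xuw eqxx => /esym/andP[_ /eqP <-]; rewrite xvu xwu !eqxx.
Qed.

Lemma same_endE v (t : bool) f : f < n + n ->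
  same_end rank_adj col sg v t f = flag_eq v t (f %/ 2) (f %% 2 == 1).
Proof.
move=> fn; rewrite /same_end /flag_eq; congr (_ || (_ && _)).
  by case: t; lia.
congr (_ && _); first by case: (sg _ _); case: t.
by case: (sg _ _); lia.
Qed.

Lemma end_idP v (t : bool) : v < n -> let f := end_id n rank_adj col sg v t in
  f < n + n /\ flag_eq v t (f %/ 2) (f %% 2 == 1).
Proof.
move=> vn; set f := end_id _ _ _ _ _ _.
have [] : same_end rank_adj col sg v t f /\ f < n + n.
  apply: (@last_indexP _ _ _ (2 * v + t)); first by clear f; case: t; lia.
  by rewrite /same_end eqxx.
by move=> h fn; rewrite same_endE in h.
Qed.

(** Identified flags have the same class and hence the same largest member; a common representative
    gives the converse by transitivity. *)
Lemma end_id_eq v (t : bool) u (t' : bool) : v < n -> u < n ->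
  (end_id n rank_adj col sg v t == end_id n rank_adj col sg u t') = flag_eq v t u t'.
Proof.
move=> vn un; apply/eqP/idP => [E|h].
  have [fn h1] := end_idP t vn; have [_ h2] := end_idP t' un.
  rewrite -E in h2; move: (end_id _ _ _ _ _ _) fn h1 h2 => f fn h1 h2 {E}.
  have f2 : f %/ 2 < n by lia.
  by apply: (flag_trans vn f2 un h1); rewrite flag_sym.
apply: eq_last_index => f fn; rewrite !same_endE //.
have f2 : f %/ 2 < n by lia.
apply/idP/idP => h'; last exact: (flag_trans vn un f2 h h').
by apply: (flag_trans un vn f2 _ h'); rewrite flag_sym.
Qed.

Definition end_of (x : G) (t : bool) : 'I_(n + n) := Ordinal (end_idP t (rank_lt x)).1.

Lemma end_of_eq x t y t' : (end_of x t == end_of y t') =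
  ((x == y) && (t == t')) ||
  [&& linkG (rank x) (rank y), sg (rank x) (rank y) == t & sg (rank y) (rank x) == t'].
Proof.
rewrite -val_eqE /= end_id_eq ?rank_lt // /flag_eq (inj_eq rank_inj) //.
Qed.

Lemma link_irr i : linkG i i = false.
Proof. by rewrite /link eqxx andbF. Qed.

Lemma end_of_neq x : end_of x false != end_of x true.
Proof. by rewrite end_of_eq eqxx link_irr. Qed.

Definition root_adj : rel 'I_(n + n) := fun a b =>
  [exists x, ((a == end_of x false) && (b == end_of x true)) ||
             ((a == end_of x true) && (b == end_of x false))].

Lemma root_adj_sym : symmetric root_adj.
Proof. by move=> a b; apply: eq_existsb => x; rewrite orbC andbC [X in _ || X]andbC. Qed.

Lemma root_adj_irr : irreflexive root_adj.
Proof.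
move=> a; apply/existsP => -[x]; rewrite [X in _ || X]andbC orbb => /andP[/eqP->].
by rewrite (negbTE (end_of_neq x)).
Qed.

Definition root_graph : sgraph := SGraph root_adj_sym root_adj_irr.

Definition root_set (x : G) : {set root_graph} := [set end_of x false; end_of x true].

Lemma root_setP (e : {set root_graph}) : reflect (exists x, e = root_set x) (e \in edge_set root_graph).
Proof.
apply: (iffP idP) => [/imset2P[a b _]|[x ->]].
  rewrite !inE => /existsP[x /orP[] /andP[/eqP-> /eqP->]] ->; exists x => //.
  by rewrite setUC.
by rewrite mem_edge_set; apply/existsP; exists x; rewrite !eqxx.
Qed.

(** There are no parallel edges: sharing both ends would require [sg (rank x) (rank y)] to be both
    false and true. *)
Lemma root_set_inj : injective root_set.
Proof.
move=> x y /eq_set2 E; apply/eqP/idPn => /negbTE xy.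
by case: E => -[/eqP E1 /eqP E2]; move: E1 E2; rewrite !end_of_eq xy /=;
  case: (sg (rank x) (rank y)); rewrite ?andbF.
Qed.

Definition root_edge (x : G) : edge root_graph :=
  exist _ (root_set x) (introT (root_setP _) (ex_intro _ x erefl)).

Lemma root_edge_ex (e : edge root_graph) : exists x, root_edge x == e.
Proof.
by have /root_setP[x E] := valP e; exists x; apply/eqP/val_inj.
Qed.

Definition edge_root (e : edge root_graph) : G := xchoose (root_edge_ex e).

Lemma edge_rootK : cancel edge_root root_edge.
Proof. by move=> e; apply/eqP; apply: xchooseP (root_edge_ex e). Qed.

Lemma root_edge_inj : injective root_edge.
Proof. by move=> x y /(congr1 val)/root_set_inj. Qed.

Lemma root_edgeK : cancel root_edge edge_root.
Proof. by move=> x; apply: root_edge_inj; rewrite edge_rootK. Qed.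

Lemma col_lt (x : G) : col (rank x) < k.
Proof. by case: hc => h _ _; apply: h (rank_lt x). Qed.

Definition root_color (e : edge root_graph) : 'I_k := Ordinal (col_lt (edge_root e)).

Lemma root_share x y : x != y -> share_end (root_edge x) (root_edge y) = linkG (rank x) (rank y).
Proof.
move=> xy; apply/set0Pn/idP => [[z]|h].
  rewrite !inE => /andP[/orP[]/eqP-> /orP[]]; rewrite end_of_eq (negbTE xy) /=; by case/and3P.
exists (end_of x (sg (rank x) (rank y))).
have E : end_of x (sg (rank x) (rank y)) = end_of y (sg (rank y) (rank x)).
  by apply/eqP; rewrite end_of_eq h !eqxx orbT.
rewrite inE {2}E !inE; apply/andP; split.
  by case: (sg (rank x) (rank y)); rewrite eqxx ?orbT.
by case: (sg (rank y) (rank x)); rewrite eqxx ?orbT.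
Qed.

Lemma root_proper : proper_coloring root_color.
Proof.
move=> e f; rewrite -(edge_rootK e) -(edge_rootK f); move: (edge_root e) (edge_root f) => x y.
rewrite (inj_eq root_edge_inj) => xy; rewrite root_share // => /andP[_].
by rewrite -val_eqE /= !root_edgeK.
Qed.

Lemma root_iso : graph_iso G (CL root_color).
Proof.
exists root_edge; first by exists edge_root; [exact: root_edgeK | exact: edge_rootK].
move=> x y; rewrite /= /cl_adj (inj_eq root_edge_inj).
case: (eqVneq x y) => [->|xy] /=; first by rewrite adj_irr.
rewrite root_share // -val_eqE /= !root_edgeK /link rank_adjE.
case: eqP => [E|_]; last by rewrite andbT orbF.
rewrite orbT -rank_adjE; apply/esym; case: hc => _ h _.
by apply: h; rewrite ?rank_lt ?(inj_eq rank_inj).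
Qed.

(** Flags can therefore serve directly as the vertex numbers in the output. *)
Lemma enum_rank_ord_val m (i : 'I_m) : enum_rank i = i :> nat.
Proof. by rewrite enum_rank_ord. Qed.

Lemma root_outputs s : reg s 3 = n + n -> reg s 4 = n ->
  (forall v, v < n -> arr s 2 v = end_id n rank_adj col sg v 0) ->
  (forall v, v < n -> arr s 3 v = end_id n rank_adj col sg v 1) ->
  (forall v, v < n -> arr s 4 v = col v) -> outputs s root_color.
Proof.
move=> r3 r4 h2 h3 h4.
pose mk x : root_graph * root_graph := (end_of x false, end_of x true).
have sz : size (map mk (enum G)) = n by rewrite size_map -cardE.
have rk (x0 : G) i : i < n -> rank (nth x0 (enum G) i) = i.
  by move=> /rankP[x ->]; rewrite nth_enum_rank.
exists (map mk (enum G)); split.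
- rewrite /edge_list -map_comp; apply: uniq_perm.
  + by rewrite map_inj_uniq ?enum_uniq //; apply: root_set_inj.
  + exact: enum_uniq.
  move=> e; rewrite mem_enum; apply/mapP/root_setP => [[x _ ->]|[x ->]]; exists x => //.
  by rewrite mem_enum.
- by rewrite sz card_ord.
- have cG : size (enum G) = n by rewrite -cardE.
  rewrite sz /tails /heads; split; apply: (@eq_from_nth _ 0);
    rewrite size_mkseq 1?size_map ?sz // => i hi; have [x0 _] := rankP hi;
    rewrite nth_mkseq // (nth_map (mk x0)) ?sz // (nth_map x0) ?cG //;
    by rewrite enum_rank_ord_val /= rk // ?h2 ?h3.
- move=> e i p; rewrite onthE => Ep Ee.
  have hi : i < n.
    by rewrite ltnNge; apply/negP => h; move: Ep; rewrite nth_default // size_map sz.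
  have [x0 _] := rankP hi; move: Ep.
  rewrite (nth_map (mk x0)) ?sz // (nth_map x0) -?cardE // => -[Ep].
  rewrite h4 // /root_color /=; congr col.
  have -> : e = root_edge (nth x0 (enum G) i) by apply: val_inj; rewrite /= Ee -Ep.
  by rewrite root_edgeK rk.
Qed.
End OutputGraph.

(** * Correctness of the whole program *)

Definition solution (k : nat) (s : state) : Prop :=
  exists (H : sgraph) (phi : edge H -> 'I_k),
    [/\ proper_coloring phi, graph_iso G (CL phi) & outputs s phi].

Lemma try_spec k g s : input_ok n rank_adj s -> (reg s 2 != 0 -> solution k s) ->
  let s' := run (P_try k g) s in
  [/\ input_ok n rank_adj s', reg s' 2 != 0 -> solution k s',
      reg s 2 != 0 -> reg s' 2 != 0 &
      forall col sg, cert n k rank_adj col sg ->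
        (forall v, v < n -> foldl (color_next n k rank_adj) (fun=> k) g v = col v) ->
        reg s' 2 != 0].
Proof.
move=> hs h2; rewrite /P_try run_if (_ : test s (Reg 2) = (reg s 2 != 0)) //.
case: (eqVneq (reg s 2) 0) => [r2|r2]; last by split.
rewrite [~~ true]/= run_seqs_cons run_seqs_cons run_seqs_cons run_seqs_nil.
set s1 := run (P_color k g) s.
pose col := foldl (color_next n k rank_adj) (fun=> k) g.
have nw r : r \in [:: 0; 2; 3] -> nwr r (P_color k g).
  rewrite !inE /= nwr_seqs all_map => h; apply/andP; split.
    by case/or3P: h => /eqP->.
  by apply/allP => c _; case/or3P: h => /eqP->.
have c1 : colored n rank_adj col s1.
  split; last by move=> u un; apply: color_spec.
  apply: input_run => //; rewrite ?nw //= nwa_seqs all_map; exact/allP.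
have r21 : reg s1 2 = 0 by rewrite reg_run ?nw.
have [c2 g2 h] := @lines_spec n k rank_adj col rank_adj_sym s1 c1.
set s2 := run (P_lines k) s1 in c2 g2 h *.
have r22 : reg s2 2 = 0.
  by rewrite reg_run //= nwr_seqs all_map; apply/allP.
have [f1 f2] := @final_spec n k rank_adj col s2 c2 g2 r22.
set s3 := run (P_final k) s2 in f1 f2 *.
have i3 : input_ok n rank_adj s3 by apply: input_run => //; case: c2.
split=> //.
- case/f1=> hc e4 a2 a3 a4.
  exists (root_graph hc), (root_color (hc := hc)); split.
  + exact: root_proper.
  + exact: root_iso.
  + by apply: root_outputs => //; case: i3.
- move=> col' sg [k1 k2 k3] E.
  (* The computed coloring agrees with [col'] on the vertices, so the certificate carries over. *)
  have hc : cert n k rank_adj col sg.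
    split.
    + by move=> v vn; rewrite /col E // k1.
    + by move=> u v un vn uv; rewrite /col !E //; apply: k2.
    + move=> v vn u w un wn uw; rewrite /link /col !E // => Lu Lw.
      by have := k3 v vn u w un wn uw Lu Lw.
  apply: f2; last by exists sg.
  by apply: h; [case: hc | exists sg; case: hc].
Qed.

Lemma tries_spec k gs s : input_ok n rank_adj s -> (reg s 2 != 0 -> solution k s) ->
  let s' := run (seqs [seq P_try k g | g <- gs]) s in
  [/\ reg s' 2 != 0 -> solution k s', reg s 2 != 0 -> reg s' 2 != 0 &
      forall col sg, cert n k rank_adj col sg -> forall g, g \in gs ->
        (forall v, v < n -> foldl (color_next n k rank_adj) (fun=> k) g v = col v) ->
        reg s' 2 != 0].
Proof.
elim: gs s => [|g gs IH] s hs h; first by [].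
rewrite map_cons run_seqs_cons.
have [i1 h1 m1 c1] := try_spec g hs h.
have [h2 m2 c2] := IH _ i1 h1; split=> //; first by move=> /m1/m2.
move=> col sg hc g'; rewrite inE => /orP[/eqP->|hg] E; last exact: c2 hc g' hg E.
by apply: m2; apply: c1 hc E.
Qed.
End Graph.

Lemma solution_color_line (G : sgraph) k s :
  solution G k s -> proper_color_line_graph k G.
Proof. by case=> H [phi [h1 h2 _]]; exists H, phi. Qed.

Lemma edge_list_size (G : sgraph) (es : seq (G * G)) :
  edge_list es -> size es = #|edge_set G|.
Proof. by move=> /perm_size; rewrite size_map -cardE. Qed.

Lemma edge_set_card (G : sgraph) : #|edge_set G| <= #|G| ^ 2.
Proof.
apply: (@leq_trans #|[set [set p.1; p.2] | p in {: G * G}]|).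
  apply/subset_leq_card/subsetP => e /imset2P[x y _ _ ->].
  by apply/imsetP; exists (x, y).
by apply: leq_trans (leq_imset_card _ _) _; rewrite card_prod mulnn.
Qed.

Lemma input_bounded (G : sgraph) (es : seq (G * G)) B :
  #|G| < B -> size es < B -> bounded B (input_state es).
Proof.
move=> hn hm; have B0 : 0 < B by apply: leq_ltn_trans hn.
split=> [[|[|r]]|a i] //=; first by rewrite nth_nil.
have lt_rank (x : G) : nat_of_ord (enum_rank x) < B by apply: ltn_trans hn; apply: ltn_ord.
case: a => [|[|a]] /=; last by rewrite !nth_nil.
  by case: (ltnP i (size es)) => hi; [case: es hi hm => // p es hi hm; rewrite (nth_map p)
    | rewrite nth_default ?size_map].
by case: (ltnP i (size es)) => hi; [case: es hi hm => // p es hi hm; rewrite (nth_map p)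
  | rewrite nth_default ?size_map].
Qed.

Theorem theorem8 (k : nat) (hk : 1 <= k) :
  exists (p : cmd) (C c : nat),
    forall (G : sgraph) (es : seq (G * G)), edge_list es ->
      let n := #|G| in
      let m := #|edge_set G| in
      exists (s : state) (t : nat),
        [/\ exec ((n + 2) ^ c) p (input_state es) s t,
            0 < n -> t <= C * (n ^ (k + 4) * (n + m)),
            accepts s <-> proper_color_line_graph k G
          & proper_color_line_graph k G ->
            exists (H : sgraph) (phi : edge H -> 'I_k),
              [/\ proper_coloring phi, graph_iso G (CL phi)
                & outputs s phi]].
Proof.
(* With this exponent, [(n + 2) ^ c0] exceeds [2 n], the number of edges and every literal of the
   program. *)
pose p := P_main k; pose c0 := maxlit p + 2.
(* The initial assignment provides the loop bound [2 n], which is also the number of output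
   vertices; it costs 4 steps. *)
exists (Seq (Assign 3 (Bin Add (Reg 0) (Reg 0))) (compile p)), (coef p + 4), (c0 * (maxesz p).+1).
move=> G es hes n m.
have em : size es = m := edge_list_size hes.
have mn : m <= n ^ 2 := edge_set_card G.
pose B := (n + 2) ^ c0.
have B2 : (n + 2) ^ 2 <= B by rewrite leq_pexp2l //; lia.
have W : (n + 2) ^ (c0 * (maxesz p).+1) = B ^ (maxesz p).+1 by rewrite expnM.
have B1 : 1 < B by apply: leq_trans B2; nia.
have BW : B <= B ^ (maxesz p).+1 by rewrite expnS leq_pmulr // expn_gt0; lia.
have hn : n + n < B by apply: leq_trans B2; nia.
have lit : maxlit p < B.
  apply: (@leq_trans (2 ^ maxlit p)); first exact: ltn_expl.
  apply: (@leq_trans ((n + 2) ^ maxlit p)); first by case: (maxlit p) => // e; rewrite leq_exp2r //; lia.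
  by rewrite leq_pexp2l //; lia.
pose s0 := set_reg (input_state es) 3 (n + n).
have b0 : bounded B s0.
  by apply: bounded_set_reg => //; apply: input_bounded; [lia | rewrite em; nia].
have z0 : sizes_ok n s0 by split; rewrite //= em.
have [_ [t et ht]] := compile_exec (wf_main k) B1 BW lit
  (leq_pexp2l (ltnW B1) (leqnSn _)) b0 z0.
have i1 : input_ok n (@rank_adj G) (run P_adj s0).
  by apply: (adj_spec hes) => //= i; rewrite ?nth_nil.
have r2 : reg (run P_adj s0) 2 = 0 by rewrite reg_run.
have [h1 _ h3] := @tries_spec G k (strings k (3 * k)) _ i1
  (fun h => False_ind _ (negP h (introT eqP r2))).
set s := run _ _ in h1 h3.
have acc : proper_color_line_graph k G -> reg s 2 != 0.
  move=> /cert_of_graph[col [sg hc]].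
  have [g hg E] := cert_coloring hk hc; exact: h3 hc g hg E.
exists s, (4 + t); split.
- rewrite W; apply: ExecSeq et; apply: ExecAssign => /=; rewrite -/n.
  have nB : n < B by lia.
  by rewrite !(leq_trans _ BW).
- move=> n0; apply: leq_trans (leq_add (leqnn 4) (ht n0)) _.
  (* Since [k] is positive, the degree is at most [k + 5], and one factor [n] is bounded by
     [n + m]. *)
  have d6 : n ^ deg p <= n ^ (k + 4) * (n + m).
    apply: (@leq_trans (n ^ (k + 5))).
      by rewrite leq_pexp2l //; apply: leq_trans (deg_main k) _; lia.
    by rewrite (_ : k + 5 = (k + 4) + 1) ?expnD ?leq_mul2l ?leq_addr ?orbT //; lia.
  have : 0 < n ^ deg p by rewrite expn_gt0 n0.
  move=> X0; rewrite addnC mulnDl leq_add ?leq_mul2l ?d6 ?orbT //.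
  by rewrite leq_pmulr // (leq_trans X0).
- split; last exact: acc.
  by move=> /h1; apply: solution_color_line.
- by move=> /acc/h1.
Qed.
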